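(* Let $d\in\mathbb N$, $r>0$ and $\varepsilon>0$. Then $$K(r,\varepsilon)\ \ge\ \frac{6\varepsilon}{(16d^2-24d+11)\,r^2}.$$ Explicitly: for every $0<\tau<\frac{6\varepsilon}{(16d^2-24d+11)r^2}$ and every compact set $\mathcal A$ of real $d\times d$ matrices, each having only real eigenvalues, with $\max_{A\in\mathcal A}\rho(A)\le r$, the inequality $\rho(I+\tau\mathcal A)\ge1$ implies $\sigma(\mathcal A)\ge-\varepsilon$.
   Context: For a compact set $\mathcal A$ of real $d\times d$ matrices, a trajectory of the associated linear switching system is an absolutely continuous $x:[0,\infty)\to\mathbb R^d$ with $\dot x(t)=A(t)x(t)$ for almost every $t$, where $A(\cdot)$ is any Lebesgue measurable function from $[0,\infty)$ to $\mathcal A$. The (worst-case) Lyapunov exponent $\sigma(\mathcal A)$ is the infimum of all $\alpha\in\mathbb R$ such that for every trajectory $x$ there is a constant $C$ with $\|x(t)\|\le Ce^{\alpha t}$ for all $t\ge0$. For a bounded set of matrices $\mathcal M$, the joint spectral radius is $\rho(\mathcal M)=\lim_{k\to\infty}\sup_{M_1,\dots,M_k\in\mathcal M}\|M_1\cdots M_k\|^{1/k}$; for a single matrix, $\rho(A)$ is its spectral radius. $I+\tau\mathcal A=\{I+\tau A: A\in\mathcal A\}$. $K(r,\varepsilon)$ denotes the largest number such that for every $\tau\in(0,K(r,\varepsilon))$ and every compact set $\mathcal A$ of real $d\times d$ matrices with only real eigenvalues and $\max_{A\in\mathcal A}\rho(A)\le r$, the inequality $\rho(I+\tau\mathcal A)\ge1$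 implies $\sigma(\mathcal A)\ge-\varepsilon$. *)

(* Defs.v *)
(* Stdlib (classical reals). Matrices/vectors are represented as
   functions on nat indices; only indices < d are ever inspected. *)
From Stdlib Require Import Reals Lra List.
Open Scope R_scope.

Definition Vec := nat -> R.
Definition Mat := nat -> nat -> R.

Fixpoint rsum (n : nat) (f : nat -> R) : R :=
  match n with O => 0 | S m => rsum m f + f m end.

Definition mvec (d : nat) (A : Mat) (x : Vec) : Vec :=
  fun i => rsum d (fun k => A i k * x k).
Definition mmul (d : nat) (A B : Mat) : Mat :=
  fun i j => rsum d (fun k => A i k * B k j).
Definition idm : Mat := fun i j => if Nat.eqb i j then 1 else 0.
Definition madd (A B : Mat) : Mat := fun i j => A i j + B i j.
Definition mscal (c : R) (A : Mat) : Mat := fun i j => c * A i j.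

Definition vnorm (d : nat) (x : Vec) : R := sqrt (rsum d (fun i => x i ^ 2)).
Definition mnorm (d : nat) (A : Mat) : R :=
  sqrt (rsum d (fun i => rsum d (fun j => A i j ^ 2))).
Definition mdist (d : nat) (A B : Mat) : R := mnorm d (fun i j => A i j - B i j).

Definition open_mset (d : nat) (U : Mat -> Prop) : Prop :=
  forall A, U A -> exists e, 0 < e /\ forall B, mdist d A B < e -> U B.
Definition compact_mset (d : nat) (S : Mat -> Prop) : Prop :=
  forall (I : Type) (U : I -> Mat -> Prop),
    (forall i, open_mset d (U i)) ->
    (forall A, S A -> exists i, U i A) ->
    exists l : list I, forall A, S A -> exists i, In i l /\ U i A.

(* a + i b is a (complex) eigenvalue of the real matrix A, with
   complex eigenvector u + i w (written out in real and imaginary parts) *)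
Definition is_eigenvalue (d : nat) (A : Mat) (a b : R) : Prop :=
  exists u w : Vec,
    (exists i, (i < d)%nat /\ (u i <> 0 \/ w i <> 0)) /\
    forall i, (i < d)%nat ->
      mvec d A u i = a * u i - b * w i /\ mvec d A w i = b * u i + a * w i.

Definition only_real_eigenvalues (d : nat) (A : Mat) : Prop :=
  forall a b, is_eigenvalue d A a b -> b = 0.

Definition spectral_radius_is (d : nat) (A : Mat) (rho : R) : Prop :=
  is_lub (fun m => exists a b, is_eigenvalue d A a b /\ m = sqrt (a ^ 2 + b ^ 2)) rho.

Definition mprod (d : nat) (l : list Mat) : Mat := fold_right (mmul d) idm l.

Definition prod_norm_roots (d : nat) (M : Mat -> Prop) (k : nat) (y : R) : Prop :=
  0 <= y /\ exists l : list Mat,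
    length l = k /\ (forall B, In B l -> M B) /\ y ^ k = mnorm d (mprod d l).

Definition jsr_is (d : nat) (M : Mat -> Prop) (l : R) : Prop :=
  exists s : nat -> R,
    (forall k, is_lub (prod_norm_roots d M (S k)) (s k)) /\ Un_cv s l.

Definition shift_set (tau : R) (AA : Mat -> Prop) : Mat -> Prop :=
  fun B => exists A, AA A /\ B = madd idm (mscal tau A).

Definition small_outer (S : R -> Prop) (eps : R) : Prop :=
  exists a b : nat -> R,
    (forall n, a n <= b n) /\
    (forall t, S t -> exists n, a n < t < b n) /\
    exists L, L < eps /\ forall N, rsum N (fun n => b n - a n) <= L.

Definition null_set (S : R -> Prop) : Prop :=
  forall eps, 0 < eps -> small_outer S eps.

Definition leb_measurable (E : R -> Prop) : Prop :=
  forall eps, 0 < eps ->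
    exists G : R -> Prop, open_set G /\ (forall t, E t -> G t) /\
      small_outer (fun t => G t /\ ~ E t) eps.

Definition measurable_mfun (d : nat) (A : R -> Mat) : Prop :=
  forall i j c, (i < d)%nat -> (j < d)%nat ->
    leb_measurable (fun t => 0 <= t /\ c < A t i j).

Definition intervals_in (a b : R) (l : list (R * R)) : Prop :=
  (forall p, In p l -> a <= fst p <= snd p /\ snd p <= b) /\
  (forall i j, (i < length l)%nat -> (j < length l)%nat -> i <> j ->
     snd (nth i l (0,0)) <= fst (nth j l (0,0)) \/
     snd (nth j l (0,0)) <= fst (nth i l (0,0))).

Definition abs_cont_on (d : nat) (a b : R) (x : R -> Vec) : Prop :=
  forall eps, 0 < eps -> exists delta, 0 < delta /\
    forall l, intervals_in a b l ->
      fold_right Rplus 0 (map (fun p => snd p - fst p) l) < delta ->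
      fold_right Rplus 0
        (map (fun p => vnorm d (fun i => x (snd p) i - x (fst p) i)) l) < eps.

Definition trajectory (d : nat) (AA : Mat -> Prop) (x : R -> Vec) : Prop :=
  exists A : R -> Mat,
    (forall t, 0 <= t -> AA (A t)) /\
    measurable_mfun d A /\
    (forall T, 0 <= T -> abs_cont_on d 0 T x) /\
    null_set (fun t => 0 <= t /\
      ~ (forall i, (i < d)%nat ->
           derivable_pt_lim (fun s => x s i) t (mvec d (A t) (x t) i))).

(* alpha belongs to the set whose infimum is sigma(AA) *)
Definition exp_bound (d : nat) (AA : Mat -> Prop) (alpha : R) : Prop :=
  forall x, trajectory d AA x ->
    exists C, forall t, 0 <= t -> vnorm d (x t) <= C * exp (alpha * t).

Definition lyap_exp_ge (d : nat) (AA : Mat -> Prop) (c : R) : Prop :=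
  forall alpha, exp_bound d AA alpha -> c <= alpha.

(* Main.v *)
(* Suppose every trajectory is O(exp (alpha t)) with alpha < -eps. Since flows are
   invertible, concatenation makes this bound uniform over all products of matrices
   exp (t A). For eps < beta < -alpha and A in AA, every entry g of
   exp (beta t) Q exp (t A) X, with Q such a product, is then a bounded exponential
   polynomial with d exponents in [-(r - beta), 0). A Markov inequality
   |g''| <= c (r - beta)^2 sup |g|, c = (16 d^2 - 24 d + 11) / 3, and a Taylor expansion
   show that trading a factor exp (t A) for I + tau A multiplies the bound by some
   q < 1 that depends only on d, r, eps, tau and beta, so products of k matrices
   I + tau A are O(q^k).

   The Markov inequality comes from comparing g with exp (-t) L (2 t) / L 0, L being
   the Laguerre polynomial of degree d - 1 and parameter -1/2. This function equals 1
   at 0, alternates at d points with amplitude at least 1 by Sonine's argument, and has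
   second derivative c at 0. Moving the exponents one at a time towards the left end of
   the interval can only increase the second derivative at 0 of the alternating
   interpolant. *)
Require Import Defs.
From Stdlib Require Import Reals Lra Lia List Permutation Arith.
From Stdlib Require Import FunctionalExtensionality Classical IndefiniteDescription.
From mathcomp Require all_boot all_algebra complex Rstruct.
From Coquelicot Require Import Coquelicot.
Open Scope R_scope.

(** * Exponential polynomials as kernels of products of D + h *)

(** In terms of c the hypothesis on tau reads tau c r^2 / 2 < eps, whereas an Euler step contracts
    as soon as tau (c (r - beta)^2 / 2 + beta^2) < beta. The weight exp (beta t) shortens the
    interval of exponents from r to r - beta, and for d >= 2 this gain pays for the term beta^2. For
    d = 1, where c = 1, it need not, and the step is computed exactly.

    Exponents may coincide, and they change with A. Exponential polynomials are therefore not
    written as sums of t^k exp (- h t) but as kernels of products of the operators D + h = exp (- h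
    t) D exp (h t). These commute, are invariant under translation and obey Rolle's theorem, so
    zeros and sign changes are counted without regard to multiplicities. Strictly positive h make
    solutions vanish at infinity, which acts as one more node each time a sign pattern is
    differentiated. *)

Definition dv (f f' : R -> R) : Prop := forall t, derivable_pt_lim f t (f' t).

Lemma dv_eq f f' g' : dv f f' -> (forall t, f' t = g' t) -> dv f g'.
Proof. intros H E t; rewrite <- E; apply H. Qed.

Lemma dv_unique f f' g' : dv f f' -> dv f g' -> f' = g'.
Proof.
intros H1 H2; extensionality t; exact (uniqueness_limite f t _ _ (H1 t) (H2 t)).
Qed.

Lemma dv_const c : dv (fun _ => c) (fun _ => 0).
Proof. intro t; apply derivable_pt_lim_const. Qed.

Lemma dv_id : dv (fun t => t) (fun _ => 1).
Proof. intro t; apply derivable_pt_lim_id. Qed.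

Lemma dv_plus f g f' g' :
  dv f f' -> dv g g' -> dv (fun t => f t + g t) (fun t => f' t + g' t).
Proof. intros Hf Hg t; exact (derivable_pt_lim_plus f g t _ _ (Hf t) (Hg t)). Qed.

Lemma dv_minus f g f' g' :
  dv f f' -> dv g g' -> dv (fun t => f t - g t) (fun t => f' t - g' t).
Proof. intros Hf Hg t; exact (derivable_pt_lim_minus f g t _ _ (Hf t) (Hg t)). Qed.

Lemma dv_opp f f' : dv f f' -> dv (fun t => - f t) (fun t => - f' t).
Proof. intros Hf t; exact (derivable_pt_lim_opp f t _ (Hf t)). Qed.

Lemma dv_mult f g f' g' :
  dv f f' -> dv g g' -> dv (fun t => f t * g t) (fun t => f' t * g t + f t * g' t).
Proof. intros Hf Hg t; exact (derivable_pt_lim_mult f g t _ _ (Hf t) (Hg t)). Qed.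

Lemma dv_comp f g f' g' :
  dv f f' -> dv g g' -> dv (fun t => f (g t)) (fun t => f' (g t) * g' t).
Proof. intros Hf Hg t; exact (derivable_pt_lim_comp g f t _ _ (Hg t) (Hf (g t))). Qed.

Lemma dv_exp g g' : dv g g' -> dv (fun t => exp (g t)) (fun t => exp (g t) * g' t).
Proof. apply (dv_comp exp); exact derivable_pt_lim_exp. Qed.

Ltac dv_step :=
  match goal with
  | H : dv ?f _ |- dv ?f _ => exact H
  | |- dv (fun _ => ?c) _ => exact (dv_const c)
  | |- dv (fun t => t) _ => exact dv_id
  | |- dv (fun t => @?f t + @?g t) _ => refine (dv_plus f g _ _ _ _)
  | |- dv (fun t => @?f t - @?g t) _ => refine (dv_minus f g _ _ _ _)
  | |- dv (fun t => - @?f t) _ => refine (dv_opp f _ _)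
  | |- dv (fun t => @?f t * @?g t) _ => refine (dv_mult f g _ _ _ _)
  | |- dv (fun t => exp (@?g t)) _ => refine (dv_exp g _ _)
  | H : dv ?f _ |- dv (fun t => ?f (@?g t)) _ => refine (dv_comp f g _ _ H _)
  end.
Ltac dv_auto := eapply dv_eq; [repeat dv_step | intro; simpl; try ring].

Lemma dv_continuity f f' : dv f f' -> forall t, continuity_pt f t.
Proof. intros H t; apply derivable_continuous_pt; exists (f' t); apply H. Qed.

Lemma dv_mvt f f' a b : dv f f' -> a < b ->
  exists c, a < c < b /\ f b - f a = f' c * (b - a).
Proof.
intros H ab.
destruct (MVT_cor2 f f' a b ab (fun c _ => H c)) as (c & E & I); exists c; auto.
Qed.

Lemma dv_nondecreasing f f' a b : dv f f' -> a <= b ->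
  (forall t, a <= t <= b -> 0 <= f' t) -> f a <= f b.
Proof.
intros H [ab | ->] P; [ | lra].
destruct (dv_mvt f f' a b H ab) as (c & I & E).
assert (0 <= f' c * (b - a)) by (apply Rmult_le_pos; [apply P | ]; lra); lra.
Qed.

(* [Lop [h1; ...; hm] f g] means (D + hm) ... (D + h1) f = g, where D = d/dt. *)
Fixpoint Lop (l : list R) (f g : R -> R) : Prop :=
  match l with
  | nil => f = g
  | h :: l' => exists f1, dv f (fun t => f1 t - h * f t) /\ Lop l' f1 g
  end.

(** For distinct entries this is the span of the exp (- h t); a repeated entry brings in powers of
    t, so multiple eigenvalues need no separate treatment. *)
Definition sol (l : list R) (f : R -> R) : Prop := Lop l f (fun _ => 0).

Lemma Lop_lin l a b : forall f f' g g', Lop l f g -> Lop l f' g' ->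
  Lop l (fun t => a * f t + b * f' t) (fun t => a * g t + b * g' t).
Proof.
induction l as [ | h l IH]; simpl; intros f f' g g'.
- now intros -> ->.
- intros (f1 & D1 & L1) (f2 & D2 & L2).
  exists (fun t => a * f1 t + b * f2 t); split; [ | now apply IH].
  dv_auto.
Qed.

Lemma sol_lin l a b f g : sol l f -> sol l g -> sol l (fun t => a * f t + b * g t).
Proof.
intros Hf Hg; unfold sol; replace (fun _ : R => 0) with (fun _ : R => a * 0 + b * 0).
- exact (Lop_lin l a b _ _ _ _ Hf Hg).
- extensionality t; ring.
Qed.

Lemma Lop_app l l' : forall f g,
  Lop (l ++ l') f g <-> exists k, Lop l f k /\ Lop l' k g.
Proof.
induction l as [ | h l IH]; simpl; intros f g; split.
- intros H; exists f; auto.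
- now intros (k & -> & H).
- intros (f1 & D1 & H); apply IH in H; destruct H as (k & H1 & H2).
  exists k; split; auto; exists f1; auto.
- intros (k & (f1 & D1 & H1) & H2); exists f1; split; auto.
  apply IH; exists k; auto.
Qed.

(** The new intermediate function is (D + k) f = (D + h) f + (k - h) f. *)
Lemma Lop_swap h k l f g : Lop (h :: k :: l) f g -> Lop (k :: h :: l) f g.
Proof.
simpl; intros (f1 & D1 & f2 & D2 & H).
exists (fun t => f1 t + (k - h) * f t); split.
- dv_auto.
- exists f2; split; auto; dv_auto.
Qed.

Lemma Lop_perm l l' : Permutation l l' -> forall f g, Lop l f g -> Lop l' f g.
Proof.
induction 1 as [ | h l l' _ IH | h k l | l1 l2 l3 _ IH1 _ IH2]; intros f g; auto.
- intros (f1 & D1 & H); exists f1; auto.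
- apply Lop_swap.
Qed.

(** D commutes with each D + h. For g = 0 this makes the derivative of a solution a solution again,
    so solutions are smooth. *)
Lemma Lop_dv l : forall f g g', Lop l f g -> dv g g' ->
  exists f', dv f f' /\ Lop l f' g'.
Proof.
induction l as [ | h l IH]; simpl; intros f g g'.
- intros -> D; exists g'; auto.
- intros (f1 & D1 & L1) D; destruct (IH _ _ _ L1 D) as (f1' & D1' & L1').
  exists (fun t => f1 t - h * f t); split; auto.
  exists f1'; split; auto; dv_auto.
Qed.

Lemma sol_dv l f : sol l f -> exists f', dv f f' /\ sol l f'.
Proof. intro H; exact (Lop_dv l f _ _ H (dv_const 0)). Qed.

Lemma Lop_dv_eq l f g f' g' : Lop l f g -> dv f f' -> dv g g' -> Lop l f' g'.
Proof.
intros L Df Dg; destruct (Lop_dv l f g g' L Dg) as (f2 & D2 & L2).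
now rewrite (dv_unique _ _ _ Df D2).
Qed.

Lemma sol_dv_eq l f f' : sol l f -> dv f f' -> sol l f'.
Proof. intros S D; exact (Lop_dv_eq l f _ f' _ S D (dv_const 0)). Qed.

(** D + h is applied last and then commuted to the front. *)
Lemma Lop_snoc h l f k g :
  Lop l f k -> dv k (fun t => g t - h * k t) -> Lop (h :: l) f g.
Proof.
intros L D.
apply (Lop_perm (l ++ h :: nil)).
- apply Permutation_sym, Permutation_cons_append.
- apply Lop_app; exists k; split; auto; exists g; split; auto; reflexivity.
Qed.

Lemma sol_cons h l f : sol l f -> sol (h :: l) f.
Proof. intro H; apply (Lop_snoc h l f _ _ H); dv_auto. Qed.

Lemma sol_shift u l : forall f, sol l f -> sol l (fun t => f (t + u)).
Proof.
unfold sol; induction l as [ | h l IH]; simpl; intros f.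
- now intros ->.
- intros (f1 & D1 & H); exists (fun t => f1 (t + u)); split; auto.
  dv_auto.
Qed.

Lemma exp_ode_const h k : dv k (fun t => - h * k t) ->
  forall t x, k t = k x * exp (- h * (t - x)).
Proof.
intros D t x.
assert (Dz : dv (fun t => exp (h * t) * k t) (fun _ => 0)) by dv_auto.
assert (E : exp (h * t) * k t = exp (h * x) * k x).
{ destruct (Rtotal_order t x) as [L | [-> | L]]; auto;
  destruct (dv_mvt _ _ _ _ Dz L) as (c & _ & E); lra. }
replace (- h * (t - x)) with (h * x + - (h * t)) by ring.
rewrite exp_plus, exp_Ropp.
generalize (exp_pos (h * t)); intro P.
apply (Rmult_eq_reg_l (exp (h * t))); [ | lra].
rewrite E; field; lra.
Qed.

(** * Decay at infinity and existence of solutions *)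

Definition tends_to_0 (f : R -> R) : Prop :=
  forall e, 0 < e -> exists T, forall t, T <= t -> Rabs (f t) < e.

Lemma tends_to_0_lin a b f g :
  tends_to_0 f -> tends_to_0 g -> tends_to_0 (fun t => a * f t + b * g t).
Proof.
intros Hf Hg e He.
assert (A1 := Rabs_pos a); assert (B1 := Rabs_pos b).
set (m := Rabs a + Rabs b + 1).
assert (He' : 0 < e / m) by (apply Rdiv_lt_0_compat; unfold m; lra).
destruct (Hf _ He') as (T1 & H1), (Hg _ He') as (T2 & H2).
exists (Rmax T1 T2); intros t Ht.
assert (X1 := H1 t (Rle_trans _ _ _ (Rmax_l _ _) Ht)).
assert (X2 := H2 t (Rle_trans _ _ _ (Rmax_r _ _) Ht)).
apply Rle_lt_trans with (1 := Rabs_triang _ _); rewrite !Rabs_mult.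
replace e with (Rabs a * (e / m) + Rabs b * (e / m) + e / m)
  by (unfold m; field; unfold m in *; lra).
assert (Rabs a * Rabs (f t) <= Rabs a * (e / m)) by (apply Rmult_le_compat_l; lra).
assert (Rabs b * Rabs (g t) <= Rabs b * (e / m)) by (apply Rmult_le_compat_l; lra).
lra.
Qed.

Lemma exp_decay_tends_to_0 f C c : 0 < c ->
  (forall t, 0 <= t -> Rabs (f t) <= C * exp (- c * t)) -> tends_to_0 f.
Proof.
intros Hc H e He.
assert (HC : 0 <= C).
{ specialize (H 0 (Rle_refl 0)); rewrite Rmult_0_r, exp_0 in H.
  generalize (Rabs_pos (f 0)); lra. }
exists (Rmax 0 (C / (e * c))); intros t Ht.
assert (t0 : 0 <= t) by (apply Rle_trans with (2 := Ht), Rmax_l).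
assert (t1 : C / (e * c) <= t) by (apply Rle_trans with (2 := Ht), Rmax_r).
apply Rle_lt_trans with (1 := H t t0).
assert (E : 1 + c * t <= exp (c * t)) by apply exp_ineq1_le.
replace (- c * t) with (- (c * t)) by ring; rewrite exp_Ropp.
assert (0 <= c * t) by (apply Rmult_le_pos; lra).
assert (P := exp_pos (c * t)).
apply (Rmult_lt_reg_r (exp (c * t))); auto.
rewrite Rmult_assoc, Rinv_l, Rmult_1_r by lra.
apply Rlt_le_trans with (e * (1 + c * t)); [ | apply Rmult_le_compat_l; lra].
apply (Rmult_le_compat_l (e * c)) in t1; [ | apply Rmult_le_pos; lra].
replace (e * c * (C / (e * c))) with C in t1 by (field; lra).
nra.
Qed.

(** exp (h t) f has derivative exp (h t) f1, and f1 decays by induction; f and - f are compared with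
    a primitive of the resulting bound. *)
Lemma sol_decay l : (forall h, In h l -> 0 < h) -> forall f, sol l f ->
  exists C c, 0 < c /\ forall t, 0 <= t -> Rabs (f t) <= C * exp (- c * t).
Proof.
unfold sol; induction l as [ | h l IH]; simpl; intros Pos f.
- intros ->; exists 0, 1; split; [lra | ]; intros; rewrite Rabs_R0; lra.
- intros (f1 & D & H).
  assert (Hh : 0 < h) by (apply Pos; auto).
  destruct (IH (fun k Hk => Pos k (or_intror Hk)) _ H) as (C1 & c1 & Hc1 & B1).
  (* Staying below h / 2 keeps h - c positive, so resonance between h and the rate of f1 produces no
     factor t. *)
  set (c := Rmin c1 (h / 2)).
  assert (Hc : 0 < c) by (apply Rmin_glb_lt; lra).
  assert (c <= c1) by apply Rmin_l.
  assert (c <= h / 2) by apply Rmin_r.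
  assert (HC1 : 0 <= C1).
  { specialize (B1 0 (Rle_refl 0)); rewrite Rmult_0_r, exp_0 in B1.
    generalize (Rabs_pos (f1 0)); lra. }
  (* This choice makes C exp ((h - c) t) a primitive of C1 exp ((h - c) t). *)
  set (C := C1 / (h - c)).
  assert (HC : 0 <= C) by (apply Rmult_le_pos; auto; left; apply Rinv_0_lt_compat; lra).
  assert (EC : C * (h - c) = C1) by (unfold C; field; lra).
  exists (Rabs (f 0) + C), c; split; auto; intros t Ht.
  assert (key : forall s, s = 1 \/ s = -1 ->
    exp (h * t) * (s * f t) <= Rabs (f 0) + C * exp ((h - c) * t)).
  { intros s Hs.
    assert (Dm : dv (fun t => C * exp ((h - c) * t) - exp (h * t) * (s * f t))
      (fun t => C1 * exp ((h - c) * t) - exp (h * t) * (s * f1 t))).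
    { dv_auto. rewrite <- EC; ring. }
    assert (M := dv_nondecreasing _ _ 0 t Dm Ht); simpl in M.
    rewrite !Rmult_0_r, exp_0 in M.
    assert (s * f 0 <= Rabs (f 0)) by
      (destruct Hs as [-> | ->]; [generalize (Rle_abs (f 0)) |
        generalize (Rle_abs (- f 0)); rewrite Rabs_Ropp]; lra).
    assert (C - s * f 0 <= C * exp ((h - c) * t) - exp (h * t) * (s * f t)).
    { replace (C - s * f 0) with (C * 1 - 1 * (s * f 0)) by ring.
      apply M; intros u Hu.
      assert (Bu := B1 u (proj1 Hu)).
      assert (s * f1 u <= Rabs (f1 u)) by
        (destruct Hs as [-> | ->]; [generalize (Rle_abs (f1 u)) |
        generalize (Rle_abs (- f1 u)); rewrite Rabs_Ropp]; lra).
      replace ((h - c) * u) with (h * u + - c * u) by ring; rewrite exp_plus.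
      assert (exp (- c1 * u) <= exp (- c * u)).
      { destruct (Req_dec (- c1 * u) (- c * u)) as [-> | N]; [lra | ].
        left; apply exp_increasing; nra. }
      assert (P := exp_pos (h * u)).
      assert (s * f1 u <= C1 * exp (- c * u)) by nra.
      nra. }
    lra. }
  assert (P := exp_pos (h * t)).
  apply (Rmult_le_reg_l (exp (h * t))); auto.
  assert (E : exp (h * t) * exp (- c * t) = exp ((h - c) * t))
    by (rewrite <- exp_plus; f_equal; ring).
  assert (G : exp (h * t) * Rabs (f t) <= Rabs (f 0) + C * exp ((h - c) * t)).
  { unfold Rabs at 1; destruct (Rcase_abs (f t)).
    - replace (- f t) with (-1 * f t) by ring; auto.
    - replace (f t) with (1 * f t) by ring; auto. }
  assert (1 <= exp ((h - c) * t)).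
  { rewrite <- exp_0; destruct Ht as [Ht | <-]; [left; apply exp_increasing; nra |
     rewrite Rmult_0_r; lra]. }
  assert (A := Rabs_pos (f 0)).
  nra.
Qed.

Lemma sol_tends_to_0 l f : (forall h, In h l -> 0 < h) -> sol l f -> tends_to_0 f.
Proof.
intros P S; destruct (sol_decay l P f S) as (C & c & Hc & B).
exact (exp_decay_tends_to_0 f C c Hc B).
Qed.

(** Variation of constants: f is exp (- h t) times the integral of exp (h s) g s. *)
Lemma ode1_exists h g : (forall t, continuity_pt g t) ->
  exists f, dv f (fun t => g t - h * f t).
Proof.
intro Cg.
set (w := fun t => exp (h * t) * g t).
assert (Cw : forall t, continuous w t).
{ intro t; apply continuity_pt_filterlim; unfold w.
  apply continuity_pt_mult; auto.
  apply dv_continuity with (fun t => exp (h * t) * h).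
  dv_auto. }
assert (DF : dv (fun t => RInt w 0 t) w).
{ intro t; apply is_derive_Reals.
  apply is_derive_RInt with (a := 0); auto.
  apply filter_forall; intro b.
  apply (@RInt_correct R_CompleteNormedModule).
  apply (@ex_RInt_continuous R_CompleteNormedModule); intros; apply Cw. }
exists (fun t => exp (- h * t) * RInt w 0 t).
dv_auto.
unfold w.
assert (E : exp (- h * t) * exp (h * t) = 1)
  by (rewrite <- exp_plus, <- exp_0; f_equal; ring).
transitivity ((exp (- h * t) * exp (h * t)) * g t
   - h * (exp (- h * t) * RInt (fun t0 => exp (h * t0) * g t0) 0 t)); [ring | ].
rewrite E; ring.
Qed.

Lemma Lop_exists l g : (forall t, continuity_pt g t) ->
  exists f, (forall t, continuity_pt f t) /\ Lop l f g.
Proof.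
induction l as [ | h l IH]; intro Cg; simpl.
- exists g; auto.
- destruct (IH Cg) as (f1 & C1 & H).
  destruct (ode1_exists h f1 C1) as (f & D).
  exists f; split; [exact (dv_continuity _ _ D) | exists f1; auto].
Qed.

(** * Rolle's theorem, sign changes and interpolation *)

Definition incr (n : nat) (t : nat -> R) : Prop := forall i, (i < n)%nat -> t i < t (S i).

Lemma incr_le n t i j : incr n t -> (i <= j <= n)%nat -> t i <= t j.
Proof.
intros H [ij jn]; induction ij as [ | j ij IH]; [lra | ].
apply Rle_trans with (t j); [apply IH; lia | left; apply H; lia].
Qed.

(** The mean value theorem for exp (h t) f. The weight is positive, so D + h treats zeros and signs
    as D does. *)
Lemma rolle_weighted h f f1 a b : dv f (fun t => f1 t - h * f t) -> a < b ->
  exists c, a < c < b /\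
    exp (h * b) * f b - exp (h * a) * f a = exp (h * c) * f1 c * (b - a).
Proof.
intros D ab.
assert (Dw : dv (fun t => exp (h * t) * f t) (fun t => exp (h * t) * f1 t)) by dv_auto.
exact (dv_mvt _ _ a b Dw ab).
Qed.

Lemma interlaced_incr n t t' :
  (forall i, (i <= n)%nat -> t i < t' i < t (S i)) -> incr n t'.
Proof.
intros H i Hi; generalize (H i ltac:(lia)) (H (S i) ltac:(lia)); lra.
Qed.

(** Each factor D + h costs one zero, by Rolle's theorem between neighbours; with one zero more than
    factors, one survives. *)
Lemma Lop_zeros l : forall f g t, Lop l f g -> incr (length l) t ->
  (forall i, (i <= length l)%nat -> f (t i) = 0) -> exists x, g x = 0.
Proof.
induction l as [ | h l IH]; simpl; intros f g t.
- intros -> _ Z; exists (t 0%nat); apply Z; lia.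
- intros (f1 & D & H) I Z.
  (* The range condition stands below the existential, with a dummy witness outside the range, so
     that [functional_choice] gives a total sequence. *)
  assert (E : forall i, exists c, (i <= length l)%nat -> t i < c < t (S i) /\ f1 c = 0).
  { intro i; destruct (le_dec i (length l)) as [Hi | Hi]; [ | exists 0; lia].
    destruct (rolle_weighted h f f1 _ _ D (I i ltac:(lia))) as (c & Hc & E).
    exists c; intros _; split; auto.
    rewrite !Z in E by lia.
    assert (P := exp_pos (h * c)).
    assert (P2 : 0 < t (S i) - t i) by lra.
    rewrite !Rmult_0_r, Rminus_0_r in E.
    destruct (Rmult_integral _ _ (eq_sym E)) as [E1 | ]; [ | lra].
    destruct (Rmult_integral _ _ E1); lra. }
  apply functional_choice in E; destruct E as (t' & E).
  apply (IH f1 g t' H).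
  + apply (interlaced_incr _ t); intros i Hi; apply E; auto.
  + intros i Hi; apply E; auto.
Qed.

(** There are n + 1 points, and of s only the sign matters. *)
Definition alternates (n : nat) (s : R) (f : R -> R) (t : nat -> R) : Prop :=
  incr n t /\ forall i, (i <= n)%nat -> 0 < s * (-1) ^ i * f (t i).

Lemma sign_cases i : (-1) ^ i = 1 \/ (-1) ^ i = -1.
Proof.
induction i as [ | i [IH | IH]]; simpl; [left; lra | right | left]; rewrite IH; lra.
Qed.

Lemma alternates_Dplus n s h f f1 t : dv f (fun t => f1 t - h * f t) ->
  alternates (S n) s f t ->
  exists t', alternates n (- s) f1 t' /\ t 0%nat < t' 0%nat.
Proof.
intros D [I A].
assert (E : forall i, exists c, (i <= n)%nat ->
  t i < c < t (S i) /\ 0 < - s * (-1) ^ i * f1 c).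
{ intro i; destruct (le_dec i n) as [Hi | Hi]; [ | exists 0; lia].
  destruct (rolle_weighted h f f1 _ _ D (I i ltac:(lia))) as (c & Hc & E).
  exists c; intros _; split; auto.
  assert (A1 := A i ltac:(lia)); assert (A2 := A (S i) ltac:(lia)); simpl in A2.
  assert (P := exp_pos (h * c)); assert (P1 := exp_pos (h * t i));
  assert (P2 := exp_pos (h * t (S i))).
  apply (Rmult_lt_reg_r (exp (h * c) * (t (S i) - t i))).
  - apply Rmult_lt_0_compat; lra.
  - rewrite Rmult_0_l.
    replace (- s * (-1) ^ i * f1 c * (exp (h * c) * (t (S i) - t i)))
      with (- s * (-1) ^ i * (exp (h * c) * f1 c * (t (S i) - t i))) by ring.
    rewrite <- E.
    assert (0 < exp (h * t (S i)) * (s * (-1 * (-1) ^ i) * f (t (S i))))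
      by (apply Rmult_lt_0_compat; auto).
    assert (0 < exp (h * t i) * (s * (-1) ^ i * f (t i)))
      by (apply Rmult_lt_0_compat; auto).
    lra. }
apply functional_choice in E; destruct E as (t' & E).
exists t'; split; [split | ].
- apply (interlaced_incr _ t); intros i Hi; apply E; auto.
- intros i Hi; apply E; auto.
- apply E; lia.
Qed.

(** Each factor consumes one point and reverses the sign, so as many factors as sign changes leave a
    single point of known sign. *)
Lemma alternates_Lop l : forall s f g t, Lop l f g -> alternates (length l) s f t ->
  exists x, 0 < s * (-1) ^ length l * g x.
Proof.
induction l as [ | h l IH]; simpl; intros s f g t.
- intros -> [_ A]; exists (t 0%nat); apply (A 0%nat); lia.
- intros (f1 & D & H) A.
  destruct (alternates_Dplus _ s h f f1 t D A) as (t' & A' & _).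
  destruct (IH _ _ _ _ H A') as (x & Hx); exists x.
  replace (s * (-1 * (-1) ^ length l)) with (- s * (-1) ^ length l) by ring; auto.
Qed.

(** The limit 0 at infinity replaces the point that differentiation would lose. All points move to
    the right, which leaves room for a new first point. *)
Lemma alternates_dv_tends_to_0 n s f f' t : dv f f' -> tends_to_0 f ->
  alternates n s f t ->
  exists t', alternates n (- s) f' t' /\ t 0%nat < t' 0%nat.
Proof.
intros D Z [I A].
assert (Hn := A n (le_n n)).
assert (P : 0 < Rabs (f (t n))).
{ apply Rabs_pos_lt; intro E; rewrite E in Hn; lra. }
destruct (Z _ P) as (T & HT).
(* Here f is smaller in modulus than at the last point, so f (t n) - f u has the sign of f (t n). *)
set (u := Rmax T (t n + 1)).
assert (HTu : T <= u) by apply Rmax_l.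
assert (Hu : t n + 1 <= u) by apply Rmax_r.
set (t1 := fun i => if le_dec i n then t i else u).
assert (E1 : forall i, (i <= n)%nat -> t1 i = t i)
  by (intros i Hi; unfold t1; destruct (le_dec i n); [auto | lia]).
assert (E2 : t1 (S n) = u) by (unfold t1; destruct (le_dec (S n) n); [lia | auto]).
assert (I1 : incr (S n) t1).
{ intros i Hi; destruct (Nat.eq_dec i n) as [-> | N].
  - rewrite E1, E2 by lia; lra.
  - rewrite !E1 by lia; apply I; lia. }
assert (J : forall i, (i <= n)%nat -> 0 < s * (-1) ^ i * (f (t1 i) - f (t1 (S i)))).
{ intros i Hi; destruct (Nat.eq_dec i n) as [-> | N].
  - rewrite E1, E2 by lia.
    assert (Q := HT u HTu).
    assert (X : Rabs (s * (-1) ^ n * f u) < s * (-1) ^ n * f (t n)).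
    { rewrite <- (Rabs_pos_eq (s * (-1) ^ n * f (t n))) by lra.
      rewrite !(Rabs_mult (s * (-1) ^ n)); apply Rmult_lt_compat_l; auto.
      apply Rabs_pos_lt; intro E; rewrite E in Hn; lra. }
    apply Rabs_def2 in X; lra.
  - rewrite !E1 by lia.
    assert (X1 := A i Hi); assert (X2 := A (S i) ltac:(lia)); simpl in X2; lra. }
assert (E : forall i, exists c, (i <= n)%nat ->
  t1 i < c < t1 (S i) /\ 0 < - s * (-1) ^ i * f' c).
{ intro i; destruct (le_dec i n) as [Hi | Hi]; [ | exists 0; lia].
  assert (L := I1 i ltac:(lia)).
  destruct (dv_mvt f f' _ _ D L) as (c & Hc & E).
  exists c; intros _; split; auto.
  apply (Rmult_lt_reg_r (t1 (S i) - t1 i)); [lra | ].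
  rewrite Rmult_0_l, Rmult_assoc, <- E; generalize (J i Hi); lra. }
apply functional_choice in E; destruct E as (t' & E).
exists t'; split; [split | ].
- apply (interlaced_incr _ t1); intros i Hi; apply E; auto.
- intros i Hi; apply E; auto.
- rewrite <- (E1 0%nat) by lia; apply E; lia.
Qed.

(** By induction on the exponents: a solution z vanishing at all nodes but the last corrects the
    last value. It is e - p, where the remaining operators send e to exp (- h t) and p interpolates
    e in their kernel. *)
Lemma interpolation l : forall (t y : nat -> R), incr (pred (length l)) t ->
  exists f, sol l f /\ forall i, (i < length l)%nat -> f (t i) = y i.
Proof.
induction l as [ | h l IH]; intros t y I; simpl in I.
- exists (fun _ => 0); split; [reflexivity | simpl; lia].
- assert (I' : incr (pred (length l)) t) by (intros i Hi; apply I; lia).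
  assert (Dk : dv (fun t => exp (- h * t)) (fun t => 0 - h * exp (- h * t))) by dv_auto.
  destruct (Lop_exists l _ (dv_continuity _ _ Dk)) as (e & _ & Le).
  destruct (IH t (fun i => e (t i)) I') as (p & Sp & Ep).
  assert (Lz : Lop l (fun t => 1 * e t + -1 * p t) (fun t => exp (- h * t))).
  { replace (fun t => exp (- h * t)) with (fun t => 1 * exp (- h * t) + -1 * 0)
      by (extensionality u; ring).
    apply Lop_lin; auto. }
  set (z := fun t => 1 * e t + -1 * p t) in Lz.
  assert (Z0 : forall i, (i < length l)%nat -> z (t i) = 0)
    by (intros i Hi; unfold z; rewrite Ep by auto; ring).
  assert (Z1 : z (t (length l)) <> 0).
  (* One more zero would force exp (- h t) itself to vanish somewhere. *)
  { intro E.
    destruct (Lop_zeros l _ _ t Lz I) as (x & Hx).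
    - intros i Hi; destruct (Nat.eq_dec i (length l)) as [-> | ]; auto.
      apply Z0; lia.
    - simpl in Hx; generalize (exp_pos (- h * x)); lra. }
  destruct (IH t y I') as (f & Sf & Ef).
  exists (fun u => 1 * f u + (y (length l) - f (t (length l))) / z (t (length l)) * z u).
  split.
  + apply sol_lin; [now apply sol_cons | ].
    exact (Lop_snoc h l z _ _ Lz Dk).
  + intros i Hi; destruct (Nat.eq_dec i (length l)) as [-> | N].
    * field; auto.
    * simpl in Hi; rewrite (Z0 i), Ef by lia; ring.
Qed.

(* If [g''(0)] exceeded [q''(0)], then for some [lam < 1] close to 1 the second
   derivative of [f = q - lam g] would alternate at [n + 2] points, starting with
   a negative value at 0. Applying [(D + a) L] with [L = prod (D + h)], [h] in [l],
   kills [g] and turns [q''] into [a'^2 (a - a') L q], whose sign is the wrong one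
   because [q] itself alternates at [n + 1] points. *)
Lemma exponent_exchange l a a' q q1 q2 g g1 g2 t :
  0 < a <= a' -> (forall h, In h l -> 0 < h) ->
  sol (a' :: l) q -> dv q q1 -> dv q1 q2 ->
  sol (a :: l) g -> dv g g1 -> dv g1 g2 ->
  incr (length l) t -> 0 <= t 0%nat ->
  (forall i, (i <= length l)%nat -> 1 <= (-1) ^ i * q (t i)) ->
  (forall i, (i <= length l)%nat -> Rabs (g (t i)) <= 1) ->
  g2 0 <= q2 0.
Proof.
intros Ha Pos Sq Dq Dq1 Sg Dg Dg1 I t0 Aq Bg.
destruct (Rle_or_lt (g2 0) (q2 0)) as [ | Lt]; auto; exfalso.
set (n := length l) in *.
assert (Hlam : exists lam, 0 < lam < 1 /\ q2 0 < lam * g2 0).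
{ exists (1 - Rmin (1 / 2) ((g2 0 - q2 0) / (2 * (Rabs (g2 0) + 1)))).
  assert (G := Rabs_pos (g2 0)).
  assert (P : 0 < (g2 0 - q2 0) / (2 * (Rabs (g2 0) + 1)))
    by (apply Rdiv_lt_0_compat; lra).
  set (m := Rmin _ _).
  assert (M1 : m <= 1 / 2) by apply Rmin_l.
  assert (M2 : m <= (g2 0 - q2 0) / (2 * (Rabs (g2 0) + 1))) by apply Rmin_r.
  assert (M3 : 0 < m) by (apply Rmin_glb_lt; lra).
  split; [lra | ].
  assert (m * (Rabs (g2 0) + 1) <= (g2 0 - q2 0) / 2).
  { apply (Rmult_le_compat_r (Rabs (g2 0) + 1)) in M2; [ | lra].
    apply Rle_trans with (1 := M2); right; field; lra. }
  assert (m * g2 0 <= m * Rabs (g2 0)) by (apply Rmult_le_compat_l; [lra | apply Rle_abs]).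
  lra. }
destruct Hlam as (lam & Hlam & Hl2).
(* Only D + a' remains to kill k = L q, so k is a multiple of exp (- a' t) and has constant sign,
   which the alternation of q determines. *)
assert (Lq : exists k, Lop l q k /\ dv k (fun t => - a' * k t)).
{ assert (S' := Lop_perm _ _ (Permutation_cons_append l a') _ _ Sq).
  apply Lop_app in S'; destruct S' as (k & L & (z & Dk & Hz)).
  simpl in Hz; subst z; exists k; split; auto.
  eapply dv_eq; [exact Dk | intro; simpl; ring]. }
destruct Lq as (k & Lk & Dk).
assert (Kpos : forall x, 0 < (-1) ^ n * k x).
{ assert (Aq' : alternates (length l) 1 q t).
  { split; auto; intros i Hi; generalize (Aq i Hi); lra. }
  destruct (alternates_Lop l 1 q k t Lk Aq') as (x & Hx).
  intro u; rewrite (exp_ode_const a' k Dk u x), <- Rmult_assoc.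
  apply Rmult_lt_0_compat; [fold n in Hx; lra | apply exp_pos]. }
set (f := fun t => 1 * q t + - lam * g t).
set (f1 := fun t => 1 * q1 t + - lam * g1 t).
set (f2 := fun t => 1 * q2 t + - lam * g2 t).
assert (Df : dv f f1) by (unfold f, f1; dv_auto).
assert (Df1 : dv f1 f2) by (unfold f1, f2; dv_auto).
assert (Lf : Lop (a :: l) f (fun t => 1 * ((a - a') * k t) + - lam * 0)).
{ apply Lop_lin; auto; apply (Lop_snoc a l q k); auto.
  eapply dv_eq; [exact Dk | intro; simpl; ring]. }
(* (D + a) L f = (a - a') k, and each differentiation of k contributes a factor - a'. *)
assert (Lf2 : Lop (a :: l) f2 (fun t => a' ^ 2 * (a - a') * k t)).
{ apply Lop_dv_eq with f1 (fun t => - a' * (a - a') * k t); auto;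
    [eapply Lop_dv_eq; [exact Lf | exact Df | ] | ]; dv_auto. }
assert (Pa' : forall h, In h (a' :: l) -> 0 < h) by (intros h [<- | ]; [lra | auto]).
assert (Pa : forall h, In h (a :: l) -> 0 < h) by (intros h [<- | ]; [lra | auto]).
assert (Zf : tends_to_0 f).
{ apply tends_to_0_lin;
    [apply (sol_tends_to_0 (a' :: l)) | apply (sol_tends_to_0 (a :: l))];
    auto. }
assert (Zf1 : tends_to_0 f1).
{ apply tends_to_0_lin;
    [apply (sol_tends_to_0 (a' :: l)) | apply (sol_tends_to_0 (a :: l))];
    auto; [apply (sol_dv_eq _ q) | apply (sol_dv_eq _ g)]; auto. }
assert (Af : alternates n 1 f t).
{ split; auto; intros i Hi.
  assert (B := Bg i Hi); assert (A := Aq i Hi).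
  assert ((-1) ^ i * g (t i) <= 1).
  { apply Rle_trans with (2 := B).
    destruct (sign_cases i) as [-> | ->]; [generalize (Rle_abs (g (t i))) |
      generalize (Rle_abs (- g (t i))); rewrite Rabs_Ropp]; lra. }
  unfold f; nra. }
destruct (alternates_dv_tends_to_0 n 1 f f1 t Df Zf Af) as (t1 & A1 & H1).
destruct (alternates_dv_tends_to_0 n (-1) f1 f2 t1 Df1 Zf1 A1) as (t2 & [I2 A2] & H2).
(* Both differentiations kept n + 1 points, all positive by now; the point 0, where f2 is negative,
   is the additional one. *)
assert (A0 : alternates (length (a :: l)) (-1) f2
               (fun i => match i with O => 0 | S j => t2 j end)).
{ split.
  - intros [ | i] Hi; [lra | apply I2; simpl in Hi; unfold n; lia].
  - intros [ | i] Hi; simpl.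
    + unfold f2; lra.
    + generalize (A2 i ltac:(simpl in Hi; unfold n; lia)); lra. }
destruct (alternates_Lop _ _ _ _ _ Lf2 A0) as (x & Hx); simpl in Hx; fold n in Hx.
assert (K := Kpos x).
assert (0 <= a' ^ 2 * (a' - a)) by (apply Rmult_le_pos; [apply pow2_ge_0 | lra]).
simpl in H; nra.
Qed.

(** * The extremal function and Markov's inequality *)

Lemma dv_pow m : dv (fun t => t ^ m) (fun t => INR m * t ^ pred m).
Proof. intro t; apply derivable_pt_lim_pow. Qed.

(** (D + c) (t f) = t (D + c) f + f. *)
Lemma sol_repeat_mult_id c m : forall f, sol (repeat c m) f ->
  sol (repeat c (S m)) (fun t => t * f t).
Proof.
induction m as [ | m IH]; intros f.
- unfold sol; simpl; intros ->; exists (fun _ => 0); split; auto; dv_auto.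
- intros (f1 & D & Hs); fold (sol (repeat c m) f1) in Hs.
  exists (fun t => 1 * (t * f1 t) + 1 * f t); split.
  + dv_auto.
  + apply (sol_lin (repeat c (S m))); [now apply IH | exists f1; auto].
Qed.

Lemma sol_repeat_mult_pow c m k : forall f, sol (repeat c m) f ->
  sol (repeat c (k + m)) (fun t => t ^ k * f t).
Proof.
induction k as [ | k IH]; intros f Hs.
- replace (fun t => t ^ 0 * f t) with f; auto; extensionality t; simpl; ring.
- replace (fun t => t ^ S k * f t) with (fun t => t * (t ^ k * f t))
    by (extensionality t; simpl; ring).
  apply sol_repeat_mult_id; auto.
Qed.

Lemma sol_scale r l : forall k f, sol l f ->
  sol (map (Rmult r) l) (fun t => k * f (r * t)).
Proof.
unfold sol; induction l as [ | h l IH]; simpl; intros k f.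
- intros ->; extensionality t; ring.
- intros (f1 & D & Hs); exists (fun t => k * r * f1 (r * t)); split; auto.
  dv_auto.
Qed.

(* [Q t = exp (- t) * L (2 t) / L 0] with [L] the Laguerre polynomial of degree [n]
   and parameter -1/2. *)
Definition laguerre_function (n : nat) (Q Q1 Q2 : R -> R) : Prop :=
  dv Q Q1 /\ dv Q1 Q2 /\
  (forall t, 2 * t * Q2 t + Q1 t + (4 * INR n + 1 - 2 * t) * Q t = 0) /\
  sol (repeat 1 (S n)) Q /\
  Q 0 = 1 /\ Q1 0 = - (4 * INR n + 1) /\
  Q2 0 = (16 * INR n ^ 2 + 8 * INR n + 3) / 3 /\
  exists x, 0 < x 0%nat /\ alternates n 1 (fun x => Q (x * x)) x.

(** The boundary condition at infinity for the raising step. For x >= 1 the crude bound x^(2n+1) <=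
    (x^2)^(n+1) reduces it to the decay of t^(n+1) Q t. *)
Lemma laguerre_weighted_tends_to_0 n Q : sol (repeat 1 (S n)) Q ->
  tends_to_0 (fun x => x ^ S (2 * n) * exp (- (x * x)) * Q (x * x)).
Proof.
intros S0 e He.
assert (S1 := sol_repeat_mult_pow 1 (S n) (S n) Q S0).
assert (Z : tends_to_0 (fun t => t ^ S n * Q t)).
{ apply (sol_tends_to_0 (repeat 1 (S n + S n))); auto.
  intros h Hh; apply repeat_spec in Hh; lra. }
destruct (Z e He) as (T & HT); exists (Rmax 1 T); intros x Hx.
assert (x1 : 1 <= x) by (apply Rle_trans with (2 := Hx), Rmax_l).
assert (x2 : T <= x) by (apply Rle_trans with (2 := Hx), Rmax_r).
assert (B := HT (x * x) ltac:(nra)).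
apply Rle_lt_trans with (2 := B); rewrite !Rabs_mult.
apply Rmult_le_compat_r; [apply Rabs_pos | ].
rewrite (Rabs_pos_eq (exp _)) by (left; apply exp_pos).
assert (E1 : exp (- (x * x)) <= 1).
{ rewrite <- exp_0; left; apply exp_increasing; nra. }
assert (P := exp_pos (- (x * x))).
assert (H1 : Rabs (x ^ S (2 * n)) <= Rabs ((x * x) ^ S n)).
{ rewrite !Rabs_pos_eq by (apply pow_le; nra).
  replace (x * x) with (x ^ 2) by ring; rewrite <- pow_mult.
  apply Rle_pow; auto; lia. }
generalize (Rabs_pos (x ^ S (2 * n))); nra.
Qed.

(* The raising relation [(2n+1) Q_(n+1) = 2 t Q_n' + (2n+1-2t) Q_n] makes
   [Q_(n+1) (x^2)] a positive multiple of the derivative of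
   [x^(2n+1) exp (-x^2) Q_n (x^2)], which vanishes at 0 and at infinity. *)
Lemma laguerre_function_exists n : exists Q Q1 Q2, laguerre_function n Q Q1 Q2.
Proof.
induction n as [ | n (Q & Q1 & Q2 & D & D1 & Ode & S0 & E0 & E1 & E2 & x & Hx & A)].
- exists (fun t => exp (- 1 * t)), (fun t => - exp (- 1 * t)), (fun t => exp (- 1 * t)).
  assert (De : dv (fun t => exp (- 1 * t)) (fun t => - exp (- 1 * t))) by dv_auto.
  split; [ | split; [ | split; [ | split; [ | split; [ | split; [ | split]]]]]].
  + exact De.
  + dv_auto.
  + intro t; simpl; ring.
  + exists (fun _ => 0); split; [ | reflexivity].
    eapply dv_eq; [exact De | intro; simpl; ring].
  + rewrite Rmult_0_r; apply exp_0.
  + rewrite Rmult_0_r, exp_0; simpl; ring.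
  + rewrite Rmult_0_r, exp_0; simpl; field.
  + exists (fun _ => 1); split; [lra | split; [intros i Hi; lia | ]].
    intros i Hi; replace i with 0%nat by lia; simpl.
    generalize (exp_pos (- 1 * (1 * 1))); simpl; lra.
- set (m := INR n) in *.
  assert (Hm : 0 <= m) by apply pos_INR.
  set (c := / (2 * m + 1)).
  assert (Hc : 0 < c) by (apply Rinv_0_lt_compat; lra).
  set (X := fun t => c * (2 * t * Q1 t + (2 * m + 1 - 2 * t) * Q t)).
  (* The derivative of X, with 2 t Q2 eliminated by the differential equation of Q. *)
  set (X1 := fun t => c * ((2 * m + 2 - 2 * t) * Q1 t - (4 * m + 3 - 2 * t) * Q t)).
  set (X2 := fun t => c * ((2 * m + 2 - 2 * t) * Q2 t - 2 * Q1 t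
                           - (4 * m + 3 - 2 * t) * Q1 t + 2 * Q t)).
  assert (DX : dv X X1).
  { unfold X, X1; dv_auto.
    assert (O := Ode t).
    replace (Q1 t) with (- (2 * t * Q2 t) - (4 * m + 1 - 2 * t) * Q t) at 1 by lra.
    transitivity (c * (2 * (2 * t * Q2 t + Q1 t + (4 * m + 1 - 2 * t) * Q t)
      + (2 * m + 2 - 2 * t) * Q1 t - (4 * m + 3 - 2 * t) * Q t
      - (2 * t * Q2 t + Q1 t + (4 * m + 1 - 2 * t) * Q t)));
    [ | rewrite O; ring].
    ring_simplify; try lra. }
  assert (DX1 : dv X1 X2) by (unfold X1, X2; dv_auto).
  exists X, X1, X2.
  split; [ | split; [ | split; [ | split; [ | split; [ | split; [ | split]]]]]].
  + exact DX.
  + exact DX1.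
  + intro t; rewrite S_INR; fold m; unfold X, X1, X2.
    assert (O := Ode t).
    transitivity (c * ((2 * m + 2 - 2 * t) *
      (2 * t * Q2 t + Q1 t + (4 * m + 1 - 2 * t) * Q t))); [ring | rewrite O; ring].
  + destruct (sol_dv _ _ S0) as (Q1' & D1' & S1).
    rewrite (dv_unique _ _ _ D1' D) in S1; clear Q1' D1'.
    (* X is a combination of t (Q' - Q) and Q; multiplication by t adds one to the multiplicity of
       the exponent. *)
    replace X with (fun t => 2 * c * (t * (1 * Q1 t + - 1 * Q t)) + c * (2 * m + 1) * Q t)
      by (extensionality t; unfold X; ring).
    apply sol_lin.
    * apply (sol_repeat_mult_id 1 (S n) (fun t => 1 * Q1 t + -1 * Q t)).
      apply sol_lin; auto.
    * exact (sol_cons 1 _ _ S0).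
  + unfold X; rewrite E0; unfold c; field; lra.
  + unfold X1; rewrite E0, E1, S_INR; fold m; unfold c; field; lra.
  + unfold X2; rewrite E0, E1, E2, S_INR; fold m; unfold c; field; lra.
  + set (G := fun x => x ^ S (2 * n) * exp (- (x * x)) * Q (x * x)).
    set (G1 := fun x => x ^ (2 * n) * exp (- (x * x)) * (/ c * X (x * x))).
    assert (DG : dv G G1).
    { assert (Dp := dv_pow (S (2 * n))).
      assert (dv (fun x => - (x * x)) (fun x => - (2 * x))) by dv_auto.
      unfold G, G1, X.
      eapply dv_eq; [repeat first [apply Dp | dv_step] | ].
      intro t; rewrite S_INR, mult_INR; simpl pred; fold m; simpl INR.
      rewrite <- (Rmult_assoc (/ c)), Rinv_l, Rmult_1_l by lra.
      simpl pow; ring. }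
    assert (AG : alternates n 1 G x).
    { destruct A as [I A]; split; auto; intros i Hi; unfold G.
      assert (0 < x i) by (apply Rlt_le_trans with (1 := Hx), (incr_le n); auto; lia).
      replace (1 * (-1) ^ i * (x i ^ S (2 * n) * exp (- (x i * x i)) * Q (x i * x i)))
        with (x i ^ S (2 * n) * exp (- (x i * x i)) * (1 * (-1) ^ i * Q (x i * x i)))
        by ring.
      apply Rmult_lt_0_compat; auto.
      apply Rmult_lt_0_compat; [now apply pow_lt | apply exp_pos]. }
    destruct (alternates_dv_tends_to_0 n 1 G G1 x DG
      (laguerre_weighted_tends_to_0 n Q S0) AG)
      as (y & [Iy Ay] & Hy).
    (* G vanishes at 0 and is positive at the first node, so G1 is positive in between: this is the
       extra point needed for n + 1. *)
    destruct (dv_mvt G G1 0 (x 0%nat) DG Hx) as (u & Hu & Eu).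
    replace (G 0) with 0 in Eu by (unfold G; simpl; ring).
    assert (Gu : 0 < G1 u).
    { assert (Q0 := proj2 AG 0%nat (le_0_n n)); simpl in Q0.
      apply (Rmult_lt_reg_r (x 0%nat - 0)); lra. }
    assert (pos : forall v, 0 < v -> forall s, 0 < s * G1 v -> 0 < s * X (v * v)).
    { intros v Hv s Hs.
      assert (W : 0 < v ^ (2 * n) * exp (- (v * v)) * / c).
      { apply Rmult_lt_0_compat; [apply Rmult_lt_0_compat | now apply Rinv_0_lt_compat];
        [now apply pow_lt | apply exp_pos]. }
      apply (Rmult_lt_reg_l _ _ _ W); rewrite Rmult_0_r.
      replace (_ * (s * X (v * v))) with (s * G1 v) by (unfold G1; ring); auto. }
    exists (fun i => match i with O => u | S j => y j end); split; [lra | split].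
    * intros [ | i] Hi; [lra | apply Iy; lia].
    * intros [ | i] Hi.
      -- apply pos; [lra | simpl; lra].
      -- assert (0 < y i).
         { apply Rlt_le_trans with (y 0%nat); [lra | apply (incr_le n); auto; lia]. }
         apply pos; auto; generalize (Ay i ltac:(lia)); simpl; lra.
Qed.

(** * Sonine's argument for y x = Q (x^2), a multiple of the Hermite function exp (-x^2) H_(2n)
    (sqrt 2 x) *)

Lemma interior_critical_point F F1 a x b : dv F F1 -> a < x < b ->
  F a < F x -> F b < F x -> exists p, a < p < b /\ F1 p = 0 /\ F x <= F p.
Proof.
intros D [ax xb] Ha Hb.
destruct (continuity_ab_maj F a b) as (p & M & Hp).
- lra.
- intros c _; exact (dv_continuity F F1 D c).
- assert (Mx := M x ltac:(lra)).
  assert (ap : a < p < b).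
  { split; apply Rnot_le_lt; intro C.
    - assert (p = a) by lra; subst p; lra.
    - assert (p = b) by lra; subst p; lra. }
  exists p; split; [auto | split; auto].
  assert (pr : derivable_pt F p) by (exists (F1 p); apply D).
  rewrite <- (deriv_maximum F a b p pr (proj1 ap) (proj2 ap)
    (fun z az zb => M z ltac:(lra))).
  symmetry; apply derive_pt_eq_0, D.
Qed.

Section Sonine.
Variables (c : R) (y y1 : R -> R).
Hypotheses (D : dv y y1) (D1 : dv y1 (fun x => - 2 * (c - 2 * (x * x)) * y x)).

(** Where 2 u^2 >= c one has (y y')' = y'^2 + 2 (2 u^2 - c) y^2 >= 0. After a critical point there,
    y^2 could not decrease, contrary to its decay. *)
Lemma critical_point_bound x : tends_to_0 y -> 0 <= x -> y1 x = 0 -> y x <> 0 ->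
  2 * (x * x) < c.
Proof.
intros Z Hx Cx Nx; apply Rnot_le_lt; intro Hc.
assert (DN : dv (fun u => y u * y1 u)
  (fun u => y1 u * y1 u + 2 * (2 * (u * u) - c) * (y u * y u))) by dv_auto.
assert (DY : dv (fun u => y u * y u) (fun u => 2 * (y u * y1 u))) by dv_auto.
assert (N : forall u, x <= u -> 0 <= y u * y1 u).
{ intros u Hu; replace 0 with (y x * y1 x) by (rewrite Cx; ring).
  apply (dv_nondecreasing _ _ x u DN Hu); intros v Hv.
  assert (0 <= 2 * (2 * (v * v) - c)) by nra.
  generalize (Rle_0_sqr (y1 v)) (Rle_0_sqr (y v)); unfold Rsqr; nra. }
destruct (Z (Rabs (y x)) (Rabs_pos_lt _ Nx)) as (T & HT).
set (u := Rmax x T).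
assert (Hu : x <= u) by apply Rmax_l.
assert (B := HT u (Rmax_r x T)).
assert (M : y x * y x <= y u * y u).
{ apply (dv_nondecreasing _ _ x u DY Hu); intros v Hv; generalize (N v (proj1 Hv)); lra. }
apply Rsqr_le_abs_0 in M; lra.
Qed.

(* The Sonine function [y^2 + y'^2 / (2 (c - 2 x^2))] is nondecreasing. *)
Lemma sonine_bound x : y 0 = 1 -> y1 0 = 0 -> 0 <= x -> 2 * (x * x) < c -> y1 x = 0 ->
  1 <= y x * y x.
Proof.
intros E0 E1 Hx Hc Cx.
destruct Hx as [Hx | <-]; [ | rewrite E0; lra].
set (w := fun u => 2 * (c - 2 * (u * u))).
(* M / w is the Sonine function minus 1, so it vanishes at 0; the numerator of its derivative
   collapses to 8 u y'^2. *)
set (M := fun u => w u * (y u * y u - 1) + y1 u * y1 u).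
assert (Dw : dv w (fun u => - 8 * u)) by (unfold w; dv_auto).
assert (DM : dv M (fun u => - 8 * u * (y u * y u - 1))).
{ unfold M; dv_auto; unfold w; ring. }
assert (P : forall u, 0 <= u <= x -> 0 < w u) by (intros u Hu; unfold w; nra).
destruct (MVT_cor2 (M / w)%F
  (fun u => (- 8 * u * (y u * y u - 1) * w u - - 8 * u * M u) / Rsqr (w u)) 0 x Hx)
  as (u & E & Hu).
{ intros u Hu; apply derivable_pt_lim_div; auto.
  generalize (P u Hu); lra. }
unfold div_fct in E.
replace (M 0) with 0 in E by (unfold M; rewrite E0, E1; ring).
replace (M x) with (w x * (y x * y x - 1)) in E by (unfold M; rewrite Cx; ring).
replace (w x * (y x * y x - 1) / w x) with (y x * y x - 1) in E
  by (field; generalize (P x ltac:(lra)); lra).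
replace (- 8 * u * (y u * y u - 1) * w u - - 8 * u * M u) with (8 * u * (y1 u * y1 u)) in E
  by (unfold M; ring).
assert (0 <= 8 * u * (y1 u * y1 u) / (w u)² * (x - 0)).
{ apply Rmult_le_pos; [ | lra].
  apply Rmult_le_pos.
  - generalize (Rle_0_sqr (y1 u)); unfold Rsqr; nra.
  - left; apply Rinv_0_lt_compat, Rsqr_pos_lt; generalize (P u ltac:(lra)); lra. }
lra.
Qed.
End Sonine.

(** Around each x (S i) there is an extremum between consecutive zeros, where Sonine's bound gives
    modulus at least 1. The first point is replaced by 0, where y = 1. *)
Lemma alternation_amplitude n y y1 x c : dv y y1 ->
  dv y1 (fun x => - 2 * (c - 2 * (x * x)) * y x) ->
  tends_to_0 y -> y 0 = 1 -> y1 0 = 0 -> 0 < x 0%nat -> alternates n 1 y x ->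
  exists s, s 0%nat = 0 /\ incr n s /\ forall i, (i <= n)%nat -> 1 <= (-1) ^ i * y (s i).
Proof.
intros D D1 Z E0 E1 Hx [I A].
assert (Ez : forall i, exists z, ((i < n)%nat -> x i < z < x (S i) /\ y z = 0) /\
                (i = n -> x n < z /\ Rabs (y z) < Rabs (y (x n)))).
{ intro i; destruct (lt_eq_lt_dec i n) as [[Hi | ->] | Hi].
  - assert (L := I i Hi).
    assert (A1 := A i ltac:(lia)); assert (A2 := A (S i) ltac:(lia)); simpl in A2.
    destruct (IVT_cor y (x i) (x (S i)) (dv_continuity _ _ D)) as (z & Hz & Ez).
    + lra.
    + destruct (sign_cases i) as [E | E]; rewrite E in A1, A2; nra.
    + exists z; split; [intros _ | lia]; split; auto.
      split; apply Rnot_le_lt; intro C.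
      * assert (z = x i) by lra; subst z; rewrite Ez in A1; lra.
      * assert (z = x (S i)) by lra; subst z; rewrite Ez in A2; lra.
  - assert (P : 0 < Rabs (y (x n))).
    { apply Rabs_pos_lt; intro E; generalize (A n (le_n n)); rewrite E; lra. }
    destruct (Z _ P) as (T & HT).
    (* No zero need follow x n; a far point where y is small encloses the last extremum just as
       well. *)
    exists (Rmax (x n + 1) T); split; [lia | intros _; split].
    + generalize (Rmax_l (x n + 1) T); lra.
    + apply HT, Rmax_r.
  - exists 0; split; lia. }
apply functional_choice in Ez; destruct Ez as (z & Ez).
assert (Ep : forall i, exists p, (i < n)%nat -> z i < p < z (S i) /\ 1 <= (-1) ^ S i * y p).
{ intro i; destruct (le_lt_dec n i) as [Hi | Hi]; [exists 0; lia | ].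
  destruct (proj1 (Ez i) Hi) as [Hz1 Z1].
  assert (AS := A (S i) Hi); rewrite Rmult_1_l in AS.
  assert (Hz2 : x (S i) < z (S i) /\ (-1) ^ S i * y (z (S i)) < (-1) ^ S i * y (x (S i))).
  { destruct (Nat.eq_dec (S i) n) as [E | N].
    - destruct (proj2 (Ez (S i)) E) as [H1 H2]; rewrite <- E in H1, H2; split; auto.
      rewrite <- (Rabs_pos_eq ((-1) ^ S i * y (x (S i)))) by lra.
      apply Rle_lt_trans with (1 := Rle_abs _).
      rewrite !Rabs_mult; apply Rmult_lt_compat_l; auto.
      destruct (sign_cases (S i)) as [-> | ->]; apply Rabs_pos_lt; lra.
    - destruct (proj1 (Ez (S i)) ltac:(lia)) as [H1 ->]; split; [apply H1 | lra]. }
  set (sg := (-1) ^ S i) in *.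
  assert (DF : dv (fun u => sg * y u) (fun u => sg * y1 u)) by dv_auto.
  destruct (interior_critical_point _ _ (z i) (x (S i)) (z (S i)) DF)
    as (p & Hp & Cp & Mp).
  - split; [apply Hz1 | apply Hz2].
  - rewrite Z1; lra.
  - apply Hz2.
  - simpl in Cp, Mp; exists p; intros _; split; auto.
    assert (0 < x i) by (apply Rlt_le_trans with (1 := Hx), (incr_le n); auto; lia).
    assert (Hsg : sg = 1 \/ sg = -1) by apply sign_cases.
    assert (Cp' : y1 p = 0) by (destruct Hsg as [E | E]; rewrite E in Cp; lra).
    assert (Np : y p <> 0) by (intro E; rewrite E in Mp; lra).
    assert (Bp := critical_point_bound c y y1 D D1 p Z ltac:(lra) Cp' Np).
    assert (Sp := sonine_bound c y y1 D D1 p E0 E1 ltac:(lra) Bp Cp').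
    destruct Hsg as [E | E]; rewrite E in *; nra. }
apply functional_choice in Ep; destruct Ep as (p & Ep).
exists (fun i => match i with O => 0 | S j => p j end); split; [auto | split].
- intros [ | [ | i]] Hi.
  + generalize (proj1 (proj1 (Ez 0%nat) Hi)) (proj1 (Ep 0%nat Hi)); lra.
  + generalize (proj1 (Ep 0%nat ltac:(lia))) (proj1 (Ep 1%nat ltac:(lia))); lra.
  + generalize (proj1 (Ep (S i) ltac:(lia))) (proj1 (Ep (S (S i)) ltac:(lia))); lra.
- intros [ | i] Hi; [simpl; lra | apply Ep; lia].
Qed.

(** The change of variable r t = x^2 carries the extrema of y to the nodes. With n = d - 1 the
    second derivative at 0 is c r^2. *)
Lemma extremal_function n r : 0 < r ->
  exists q q1 q2 t, sol (repeat r (S n)) q /\ dv q q1 /\ dv q1 q2 /\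
    t 0%nat = 0 /\ incr n t /\
    (forall i, (i <= n)%nat -> 1 <= (-1) ^ i * q (t i)) /\
    q2 0 = (16 * INR n ^ 2 + 8 * INR n + 3) / 3 * r ^ 2.
Proof.
intro Hr.
destruct (laguerre_function_exists n)
  as (Q & Q1 & Q2 & D & D1 & Ode & S0 & E0 & E1 & E2 & x & Hx & A).
set (y := fun x => Q (x * x)); set (y1 := fun x => 2 * x * Q1 (x * x)).
assert (Dy : dv y y1) by (unfold y, y1; dv_auto).
assert (Dy1 : dv y1 (fun x => - 2 * (4 * INR n + 1 - 2 * (x * x)) * y x)).
{ unfold y1, y; dv_auto.
  assert (O := Ode (t * t)).
  transitivity (2 * (2 * (t * t) * Q2 (t * t) + Q1 (t * t)
     + (4 * INR n + 1 - 2 * (t * t)) * Q (t * t))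
     - 2 * (4 * INR n + 1 - 2 * (t * t)) * Q (t * t)); [ring | rewrite O; ring]. }
assert (Z : tends_to_0 y).
{ intros e He.
  assert (Zq : tends_to_0 Q).
  { apply (sol_tends_to_0 (repeat 1 (S n))); auto.
    intros h Hh; apply repeat_spec in Hh; lra. }
  destruct (Zq e He) as (T & HT).
  exists (Rmax 1 T); intros u Hu; apply HT.
  generalize (Rmax_l 1 T) (Rmax_r 1 T); nra. }
destruct (alternation_amplitude n y y1 x (4 * INR n + 1) Dy Dy1 Z)
  as (s & Es & Is & As); auto.
{ unfold y; rewrite Rmult_0_l; auto. }
{ unfold y1; ring. }
exists (fun t => 1 * Q (r * t)), (fun t => r * Q1 (r * t)), (fun t => r ^ 2 * Q2 (r * t)),
  (fun i => / r * (s i * s i)).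
split; [ | split; [ | split; [ | split; [ | split; [ | split]]]]].
- assert (S1 := sol_scale r _ 1 _ S0).
  rewrite map_repeat, Rmult_1_r in S1; exact S1.
- dv_auto.
- dv_auto.
- rewrite Es; ring.
- intros i Hi; apply Rmult_lt_compat_l; [now apply Rinv_0_lt_compat | ].
  assert (0 <= s i) by (rewrite <- Es; apply (incr_le n); auto; lia).
  generalize (Is i Hi); nra.
- intros i Hi; rewrite <- (Rmult_assoc r), Rinv_r, Rmult_1_l, Rmult_1_l by lra.
  exact (As i Hi).
- rewrite Rmult_0_r, E2; ring.
Qed.

(** The nodes stay fixed while copies of r are replaced by the entries of l one at a time;
    [exponent_exchange] compares the two alternating functions at each replacement. *)
Lemma extremal_comparison r n t c : 0 < r -> incr n t -> 0 <= t 0%nat ->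
  (exists q q1 q2, sol (repeat r (S n)) q /\ dv q q1 /\ dv q1 q2 /\
     (forall i, (i <= n)%nat -> 1 <= (-1) ^ i * q (t i)) /\ q2 0 <= c) ->
  forall l m, (length l + m = S n)%nat -> (forall h, In h l -> 0 < h <= r) ->
  exists q q1 q2, sol (l ++ repeat r m) q /\ dv q q1 /\ dv q1 q2 /\
     (forall i, (i <= n)%nat -> 1 <= (-1) ^ i * q (t i)) /\ q2 0 <= c.
Proof.
intros Hr I t0 Base l; induction l as [ | a l IH]; intros m Hm Pos.
- simpl in Hm; subst m; exact Base.
- destruct (IH (S m)) as (q & q1 & q2 & Sq & Dq & Dq1 & Aq & Bq).
  + simpl in Hm; lia.
  + intros h Hh; apply Pos; right; auto.
  + set (l' := l ++ repeat r m).
    assert (Len : length l' = n)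
      by (unfold l'; rewrite length_app, repeat_length; simpl in Hm; lia).
    assert (Sq' : sol (r :: l') q).
    { apply (Lop_perm (l ++ repeat r (S m))); auto.
      apply Permutation_sym, Permutation_middle. }
    (* Values exactly (-1)^i serve twice: g is bounded by 1 at the nodes for the present exchange
       and has amplitude 1 for the next one. *)
    destruct (interpolation (a :: l') t (fun i => (-1) ^ i)) as (g & Sg & Eg).
    { simpl; rewrite Len; auto. }
    destruct (sol_dv _ _ Sg) as (g1 & Dg & Sg1).
    destruct (sol_dv _ _ Sg1) as (g2 & Dg1 & _).
    exists g, g1, g2; split; [exact Sg | split; [auto | split; [auto | split]]].
    * intros i Hi; rewrite Eg by (simpl; lia).
      destruct (sign_cases i) as [-> | ->]; lra.
    * apply Rle_trans with (2 := Bq).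
      apply (exponent_exchange l' a r q q1 q2 g g1 g2 t); auto; try rewrite Len; auto.
      -- apply Pos; left; auto.
      -- intros h Hh; apply in_app_or in Hh; destruct Hh as [Hh | Hh].
         ++ apply Pos; right; auto.
         ++ apply repeat_spec in Hh; lra.
      -- intros i Hi; rewrite Eg by (simpl; lia).
         destruct (sign_cases i) as [-> | ->]; unfold Rabs; destruct Rcase_abs; lra.
Qed.

(** Translating by u and scaling by 1 / K or - 1 / K preserves the kernel, so only the second
    derivative at 0 of functions bounded by 1 has to be estimated. *)
Theorem exponential_markov l r K g g1 g2 u :
  l <> nil -> 0 < r -> (forall h, In h l -> 0 < h <= r) ->
  sol l g -> dv g g1 -> dv g1 g2 -> 0 < K -> 0 <= u ->
  (forall t, 0 <= t -> Rabs (g t) <= K) ->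
  Rabs (g2 u) <=
    K * ((16 * INR (length l) ^ 2 - 24 * INR (length l) + 11) / 3 * r ^ 2).
Proof.
intros Nl Hr Pos Sg Dg Dg1 HK Hu B.
destruct l as [ | a l]; [now elim Nl | clear Nl].
set (n := length l).
replace (INR (length (a :: l))) with (INR n + 1) by (simpl length; rewrite S_INR; auto).
replace ((16 * (INR n + 1) ^ 2 - 24 * (INR n + 1) + 11) / 3)
  with ((16 * INR n ^ 2 + 8 * INR n + 3) / 3) by field.
set (c := _ * r ^ 2).
destruct (extremal_function n r Hr)
  as (q0 & q01 & q02 & t & S0 & D0 & D01 & t0 & It & A0 & E0).
destruct (extremal_comparison r n t c Hr It ltac:(lra)
  ltac:(exists q0, q01, q02; repeat split; auto; rewrite E0; unfold c; lra)
  (a :: l) 0%nat ltac:(simpl; unfold n; lia) Pos)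
  as (q & q1 & q2 & Sq & Dq & Dq1 & Aq & Bq).
simpl repeat in Sq.
rewrite app_nil_r in Sq.
assert (key : forall s, s = 1 \/ s = -1 -> s * / K * g2 u <= c).
{ intros s Hs.
  apply Rle_trans with (2 := Bq).
  assert (X : s * / K * g2 (0 + u) <= q2 0); [ | now rewrite Rplus_0_l in X].
  (* With equal exponents the exchange lemma says that the alternating function is extremal within
     its own kernel. The summand 0 * 0 gives g the shape of [sol_lin]. *)
  apply (exponent_exchange l a a q q1 q2 (fun t => s * / K * g (t + u) + 0 * 0)
    (fun t => s * / K * g1 (t + u)) (fun t => s * / K * g2 (t + u)) t); auto.
  - split; [apply Pos; left; auto | lra].
  - intros h Hh; apply Pos; right; auto.
  - apply (sol_lin (a :: l) (s * / K) 0 (fun t => g (t + u)) (fun _ => 0)).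
    + now apply sol_shift.
    + clear; induction (a :: l) as [ | h l' IH]; [reflexivity | now apply sol_cons].
  - dv_auto.
  - dv_auto.
  - lra.
  - intros i Hi.
    assert (ti : 0 <= t i) by (rewrite <- t0; apply (incr_le n); auto; unfold n; lia).
    rewrite Rmult_0_l, Rplus_0_r, !Rabs_mult.
    rewrite (Rabs_pos_eq (/ K)) by (left; now apply Rinv_0_lt_compat).
    assert (B' := B (t i + u) ltac:(lra)).
    apply (Rmult_le_reg_r K); auto.
    replace (Rabs s * / K * Rabs (g (t i + u)) * K) with (Rabs s * Rabs (g (t i + u)))
      by (field; lra).
    assert (Es : Rabs s = 1)
      by (destruct Hs as [-> | ->]; unfold Rabs; destruct Rcase_abs; lra).
    rewrite Es; lra. }
assert (K1 := key 1 (or_introl eq_refl)); assert (K2 := key (-1) (or_intror eq_refl)).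
assert (HKi : K * / K = 1) by (apply Rinv_r; lra).
apply Rabs_le; split.
- replace (g2 u) with (- (K * (-1 * / K * g2 u))) by (field; lra).
  apply Ropp_le_contravar, Rmult_le_compat_l; lra.
- replace (g2 u) with (K * (1 * / K * g2 u)) by (field; lra).
  apply Rmult_le_compat_l; lra.
Qed.

(** * Matrix exponentials *)

Lemma rsum_ext n f g : (forall k, (k < n)%nat -> f k = g k) -> rsum n f = rsum n g.
Proof.
induction n as [ | n IH]; simpl; intro H; auto.
rewrite IH, H by (auto; lia); auto.
Qed.

Lemma rsum_plus n f g : rsum n (fun k => f k + g k) = rsum n f + rsum n g.
Proof. induction n as [ | n IH]; simpl; [ring | rewrite IH; ring]. Qed.

Lemma rsum_scal_l n c f : rsum n (fun k => c * f k) = c * rsum n f.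
Proof. induction n as [ | n IH]; simpl; [ring | rewrite IH; ring]. Qed.

Lemma rsum_scal_r n c f : rsum n (fun k => f k * c) = rsum n f * c.
Proof. induction n as [ | n IH]; simpl; [ring | rewrite IH; ring]. Qed.

Lemma rsum_0 n f : (forall k, (k < n)%nat -> f k = 0) -> rsum n f = 0.
Proof.
induction n as [ | n IH]; simpl; intro H; auto.
rewrite IH, H by (auto; lia); ring.
Qed.

Lemma rsum_swap n m f :
  rsum n (fun i => rsum m (fun j => f i j)) = rsum m (fun j => rsum n (fun i => f i j)).
Proof.
induction n as [ | n IH]; simpl.
- symmetry; apply rsum_0; auto.
- rewrite IH, rsum_plus; auto.
Qed.

Lemma rsum_le n f g : (forall k, (k < n)%nat -> f k <= g k) -> rsum n f <= rsum n g.
Proof.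
induction n as [ | n IH]; simpl; intro H; [lra | ].
apply Rplus_le_compat; [apply IH; auto | apply H; lia].
Qed.

Lemma rsum_nonneg n f : (forall k, (k < n)%nat -> 0 <= f k) -> 0 <= rsum n f.
Proof. intro H; rewrite <- (rsum_0 n (fun _ => 0)) by auto; apply rsum_le, H. Qed.

Lemma rsum_const n c : rsum n (fun _ => c) = INR n * c.
Proof. induction n as [ | n IH]; simpl rsum; [simpl; ring | rewrite IH, S_INR; ring]. Qed.

Lemma rsum_Rabs n f : Rabs (rsum n f) <= rsum n (fun k => Rabs (f k)).
Proof.
induction n as [ | n IH]; simpl; [rewrite Rabs_R0; lra | ].
apply Rle_trans with (1 := Rabs_triang _ _); lra.
Qed.

Lemma rsum_term_le n f k : (forall i, (i < n)%nat -> 0 <= f i) -> (k < n)%nat ->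
  f k <= rsum n f.
Proof.
induction n as [ | n IH]; simpl; intros H Hk; [lia | ].
destruct (Nat.eq_dec k n) as [-> | N].
- generalize (rsum_nonneg n f (fun i Hi => H i ltac:(lia))); lra.
- generalize (IH (fun i Hi => H i ltac:(lia)) ltac:(lia)) (H n ltac:(lia)); lra.
Qed.

Lemma rsum_delta n i f : (i < n)%nat -> rsum n (fun k => idm i k * f k) = f i.
Proof.
unfold idm; induction n as [ | n IH]; simpl; intro Hi; [lia | ].
destruct (Nat.eq_dec i n) as [-> | N].
- rewrite rsum_0, Nat.eqb_refl; [ring | ].
  intros k Hk; destruct (Nat.eqb_spec n k); [lia | ring].
- rewrite IH by lia; destruct (Nat.eqb_spec i n); [lia | ring].
Qed.

Lemma idm_sym i j : idm i j = idm j i.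
Proof. unfold idm; rewrite Nat.eqb_sym; auto. Qed.

Lemma mmul_assoc d A B C : mmul d (mmul d A B) C = mmul d A (mmul d B C).
Proof.
extensionality i; extensionality j; unfold mmul.
transitivity (rsum d (fun k => rsum d (fun l => A i l * B l k * C k j))).
- apply rsum_ext; intros k _; now rewrite <- rsum_scal_r.
- rewrite rsum_swap; apply rsum_ext; intros l _; rewrite <- rsum_scal_l.
  apply rsum_ext; intros k _; ring.
Qed.

Lemma mmul_idm_l d A i j : (i < d)%nat -> mmul d idm A i j = A i j.
Proof. intro Hi; exact (rsum_delta d i (fun k => A k j) Hi). Qed.

Lemma mmul_idm_r d A i j : (j < d)%nat -> mmul d A idm i j = A i j.
Proof.
intro Hj; unfold mmul; rewrite <- (rsum_delta d j (fun k => A i k) Hj).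
apply rsum_ext; intros k _; rewrite idm_sym; ring.
Qed.

(** [idm] is a unit for [mmul d] only on the d x d block, so identities involving it hold only
    there. *)
Definition meq (d : nat) (A B : Mat) : Prop :=
  forall i j, (i < d)%nat -> (j < d)%nat -> A i j = B i j.

Lemma meq_mmul d A A' B B' : meq d A A' -> meq d B B' -> meq d (mmul d A B) (mmul d A' B').
Proof.
intros HA HB i j Hi Hj; apply rsum_ext; intros k Hk; now rewrite HA, HB.
Qed.

(** A submultiplicative norm on the d x d block. *)
Definition entry_sum (d : nat) (A : Mat) : R :=
  rsum d (fun i => rsum d (fun j => Rabs (A i j))).

Lemma entry_sum_nonneg d A : 0 <= entry_sum d A.
Proof. do 2 (apply rsum_nonneg; intros); apply Rabs_pos. Qed.

Lemma row_le_entry_sum d A i : (i < d)%nat ->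
  rsum d (fun j => Rabs (A i j)) <= entry_sum d A.
Proof.
intro Hi; apply (rsum_term_le d (fun i => rsum d (fun j => Rabs (A i j)))); auto.
intros; apply rsum_nonneg; intros; apply Rabs_pos.
Qed.

Lemma entry_le_entry_sum d A i j : (i < d)%nat -> (j < d)%nat ->
  Rabs (A i j) <= entry_sum d A.
Proof.
intros Hi Hj; apply Rle_trans with (2 := row_le_entry_sum d A i Hi).
apply (rsum_term_le d (fun j => Rabs (A i j))); auto; intros; apply Rabs_pos.
Qed.

Lemma mmul_entry_bound d A B c i j : (i < d)%nat ->
  (forall k, (k < d)%nat -> Rabs (B k j) <= c) ->
  Rabs (mmul d A B i j) <= entry_sum d A * c.
Proof.
intros Hi H.
apply Rle_trans with (rsum d (fun k => Rabs (A i k) * c)).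
- apply Rle_trans with (1 := rsum_Rabs _ _), rsum_le; intros k Hk.
  rewrite Rabs_mult; apply Rmult_le_compat_l; [apply Rabs_pos | auto].
- rewrite rsum_scal_r; destruct d as [ | d]; [lia | ].
  apply Rmult_le_compat_r; [ | now apply row_le_entry_sum].
  apply Rle_trans with (2 := H 0%nat ltac:(lia)), Rabs_pos.
Qed.

Lemma entry_sum_mmul_le d A B : entry_sum d (mmul d A B) <= entry_sum d A * entry_sum d B.
Proof.
unfold entry_sum at 1 2; rewrite <- rsum_scal_r; apply rsum_le; intros i Hi.
apply Rle_trans with (rsum d (fun k => Rabs (A i k) * rsum d (fun j => Rabs (B k j)))).
- apply Rle_trans with (rsum d (fun j => rsum d (fun k => Rabs (A i k) * Rabs (B k j)))).
  + apply rsum_le; intros j Hj; apply Rle_trans with (1 := rsum_Rabs _ _).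
    apply rsum_le; intros k Hk; rewrite Rabs_mult; lra.
  + rewrite rsum_swap; right; apply rsum_ext; intros k Hk; apply rsum_scal_l.
- rewrite <- rsum_scal_r; apply rsum_le; intros k Hk.
  apply Rmult_le_compat_l; [apply Rabs_pos | now apply row_le_entry_sum].
Qed.

Lemma entry_sum_meq d A B : meq d A B -> entry_sum d A = entry_sum d B.
Proof. intro H; do 2 (apply rsum_ext; intros); now rewrite H. Qed.

Fixpoint mpow (d : nat) (A : Mat) (k : nat) : Mat :=
  match k with O => idm | S k => mmul d A (mpow d A k) end.

Lemma mpow_S_r d A k : meq d (mpow d A (S k)) (mmul d (mpow d A k) A).
Proof.
induction k as [ | k IH]; intros i j Hi Hj.
- simpl; now rewrite mmul_idm_l, mmul_idm_r.
- simpl mpow at 2; rewrite mmul_assoc.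
  apply (meq_mmul d A A _ _ (fun _ _ _ _ => eq_refl) IH); auto.
Qed.

Lemma mpow_bound d A k i j : (i < d)%nat ->
  Rabs (mpow d A k i j) <= (1 + entry_sum d A) ^ k.
Proof.
assert (P := entry_sum_nonneg d A).
revert i; induction k as [ | k IH]; intros i Hi; simpl.
- unfold idm; destruct Nat.eqb; unfold Rabs; destruct Rcase_abs; lra.
- apply Rle_trans with (entry_sum d A * (1 + entry_sum d A) ^ k).
  + apply mmul_entry_bound; auto.
  + apply Rmult_le_compat_r; [apply pow_le | ]; lra.
Qed.

Definition mexp_coef (d : nat) (A : Mat) (i j : nat) (k : nat) : R :=
  mpow d A k i j / INR (fact k).

(** Each entry is a scalar power series, so that termwise differentiation is available. *)
Definition mexp (d : nat) (A : Mat) (t : R) : Mat :=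
  fun i j => PSeries (mexp_coef d A i j) t.

Lemma CV_disk_pow_fact m x : 0 < m -> CV_disk (fun k => m ^ k / INR (fact k)) x.
Proof.
intro Hm; apply CV_disk_DAlembert with 0; [ | | now left].
- intro k; apply Rgt_not_eq, Rdiv_lt_0_compat; [now apply pow_lt | apply INR_fact_lt_0].
- apply is_lim_seq_ext with (fun k => m * / INR (S k)).
  + intro k.
    assert (Hk : 0 < INR (S k)) by (apply lt_0_INR; lia).
    assert (Hp : 0 < m ^ k) by now apply pow_lt.
    assert (Hf := INR_fact_lt_0 k).
    replace (m ^ S k / INR (fact (S k)) / (m ^ k / INR (fact k))) with (m * / INR (S k)).
    * rewrite Rabs_pos_eq; auto.
      left; apply Rmult_lt_0_compat; [ | apply Rinv_0_lt_compat]; lra.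
    * rewrite fact_simpl, mult_INR; simpl pow; field; lra.
  + replace (Finite 0) with (Rbar_mult m 0) by (simpl; f_equal; ring).
    apply (is_lim_seq_scal_l (fun k => / INR (S k)) m 0).
    apply (is_lim_seq_incr_1 (fun k => / INR k)).
    replace (Finite 0) with (Rbar_inv p_infty) by auto.
    apply is_lim_seq_inv; [apply is_lim_seq_INR | discriminate].
Qed.

Lemma mexp_coef_radius d A i j : (i < d)%nat ->
  CV_radius (mexp_coef d A i j) = p_infty.
Proof.
intro Hi.
assert (P := entry_sum_nonneg d A).
assert (Dk : forall x, CV_disk (mexp_coef d A i j) x).
{ intro x.
  apply (@ex_series_le R_AbsRing R_CompleteNormedModule) with
    (fun k => Rabs ((1 + entry_sum d A) ^ k / INR (fact k) * x ^ k)).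
  - intro k; unfold mexp_coef, Rdiv; simpl; unfold abs; simpl.
    rewrite Rabs_Rabsolu, !Rabs_mult.
    apply Rmult_le_compat_r; [apply Rabs_pos | ].
    apply Rmult_le_compat_r; [apply Rabs_pos | ].
    rewrite (Rabs_pos_eq ((1 + _) ^ k)) by (apply pow_le; lra).
    now apply mpow_bound.
  - apply CV_disk_pow_fact; lra. }
destruct (Lub_Rbar_correct (CV_disk (mexp_coef d A i j))) as [U _].
fold (CV_radius (mexp_coef d A i j)) in U.
destruct (CV_radius (mexp_coef d A i j)) as [r | | ]; auto.
- generalize (U (r + 1) (Dk (r + 1))); simpl; lra.
- now generalize (U 0 (Dk 0)).
Qed.

Lemma PSeries_rsum n (a : nat -> nat -> R) (c : nat -> R) t :
  (forall l, (l < n)%nat -> CV_radius (a l) = p_infty) ->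
  ex_pseries (fun k => rsum n (fun l => c l * a l k)) t /\
  PSeries (fun k => rsum n (fun l => c l * a l k)) t
    = rsum n (fun l => c l * PSeries (a l) t).
Proof.
induction n as [ | n IH]; simpl; intro H.
- assert (E : is_pseries (fun _ => 0) t 0).
  { apply is_series_ext with (fun _ : nat => 0).
    - intro k; unfold scal; simpl; unfold mult; simpl; ring.
    - apply filterlim_ext with (fun _ : nat => 0).
      + intro m; rewrite sum_n_const; ring.
      + apply filterlim_const. }
  split; [exists 0; auto | now apply is_pseries_unique].
- destruct (IH (fun l Hl => H l ltac:(lia))) as [X E].
  assert (X1 : ex_pseries (PS_scal (c n) (a n)) t).
  { apply ex_pseries_scal; [apply Rmult_comm | ].
    apply CV_radius_inside; rewrite (H n) by lia; exact I. }
  split.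
  + exact (ex_pseries_plus _ _ _ X X1).
  + rewrite <- E, <- PSeries_scal; exact (PSeries_plus _ _ _ X X1).
Qed.

Lemma mexp_PS_derive d A i j k :
  PS_derive (mexp_coef d A i j) k = mpow d A (S k) i j / INR (fact k).
Proof.
unfold PS_derive, mexp_coef; rewrite fact_simpl, mult_INR.
field; split; [apply INR_fact_neq_0 | now apply not_0_INR].
Qed.

Lemma mexp_dv_pseries d A i j : (i < d)%nat ->
  dv (fun t => mexp d A t i j) (fun t => PSeries (PS_derive (mexp_coef d A i j)) t).
Proof.
intros Hi t; apply is_derive_Reals, is_derive_PSeries.
now rewrite mexp_coef_radius.
Qed.

Lemma dv_mexp d A i j : (i < d)%nat ->
  dv (fun t => mexp d A t i j) (fun t => mmul d A (mexp d A t) i j).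
Proof.
intros Hi; eapply dv_eq; [now apply mexp_dv_pseries | intro t].
unfold mmul, mexp.
rewrite <- (proj2 (PSeries_rsum d (fun l => mexp_coef d A l j) (fun l => A i l) t
   (fun l Hl => mexp_coef_radius d A l j Hl))).
apply PSeries_ext; intro k; rewrite mexp_PS_derive; simpl; unfold mmul, mexp_coef, Rdiv.
rewrite <- rsum_scal_r; apply rsum_ext; intros l Hl; ring.
Qed.

Lemma dv_mexp_r d A i j : (i < d)%nat -> (j < d)%nat ->
  dv (fun t => mexp d A t i j) (fun t => mmul d (mexp d A t) A i j).
Proof.
intros Hi Hj; eapply dv_eq; [now apply mexp_dv_pseries | intro t].
unfold mmul, mexp.
rewrite (rsum_ext d _ (fun k => A k j * PSeries (mexp_coef d A i k) t))
  by (intros; ring).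
rewrite <- (proj2 (PSeries_rsum d (fun l => mexp_coef d A i l) (fun l => A l j) t
   (fun l Hl => mexp_coef_radius d A i l Hi))).
apply PSeries_ext; intro k; rewrite mexp_PS_derive.
rewrite (mpow_S_r d A k i j Hi Hj); unfold mmul, mexp_coef, Rdiv.
rewrite <- rsum_scal_r; apply rsum_ext; intros l Hl; ring.
Qed.

Lemma mexp_0 d A : mexp d A 0 = idm.
Proof.
extensionality i; extensionality j; unfold mexp; rewrite PSeries_0.
unfold mexp_coef; simpl; field.
Qed.

Lemma dv_rsum n (f f' : nat -> R -> R) : (forall k, (k < n)%nat -> dv (f k) (f' k)) ->
  dv (fun t => rsum n (fun k => f k t)) (fun t => rsum n (fun k => f' k t)).
Proof.
induction n as [ | n IH]; simpl; intro H.
- apply dv_const.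
- apply (dv_plus (fun t => rsum n (fun k => f k t)) (f n)); [apply IH; auto | apply H; lia].
Qed.

Lemma dv_mmul d (A A' B B' : R -> Mat) i j :
  (forall k, (k < d)%nat -> dv (fun t => A t i k) (fun t => A' t i k)) ->
  (forall k, (k < d)%nat -> dv (fun t => B t k j) (fun t => B' t k j)) ->
  dv (fun t => mmul d (A t) (B t) i j)
     (fun t => mmul d (A' t) (B t) i j + mmul d (A t) (B' t) i j).
Proof.
intros HA HB; eapply dv_eq.
- apply (dv_rsum d (fun k t => A t i k * B t k j)
           (fun k t => A' t i k * B t k j + A t i k * B' t k j)).
  intros k Hk; exact (dv_mult _ _ _ _ (HA k Hk) (HB k Hk)).
- intro t; apply rsum_plus.
Qed.

Lemma dv_0_const f : dv f (fun _ => 0) -> forall a b, f a = f b.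
Proof.
intros D a b; destruct (Rtotal_order a b) as [L | [-> | L]]; auto;
destruct (dv_mvt _ _ _ _ D L) as (c & _ & E); lra.
Qed.

Lemma mmul_opp_l d A B i j : mmul d (fun i j => - A i j) B i j = - mmul d A B i j.
Proof.
unfold mmul; replace (- rsum d (fun k => A i k * B k j))
  with (-1 * rsum d (fun k => A i k * B k j)) by ring.
rewrite <- rsum_scal_l; apply rsum_ext; intros; ring.
Qed.

(** exp ((t + s - u) A) exp (u A) does not depend on u; compare u = 0 with u = s. *)
Lemma mexp_plus d A t s : meq d (mexp d A (t + s)) (mmul d (mexp d A t) (mexp d A s)).
Proof.
intros i j Hi Hj.
set (F := fun u => mmul d (mexp d A (t + s - u)) (mexp d A u) i j).
assert (D : dv F (fun _ => 0)).
{ eapply dv_eq.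
  - apply (dv_mmul d (fun u => mexp d A (t + s - u))
      (fun u i k => - mmul d (mexp d A (t + s - u)) A i k) (fun u => mexp d A u)
      (fun u => mmul d A (mexp d A u))).
    + intros k Hk; assert (D := dv_mexp_r d A i k Hi Hk).
      eapply dv_eq; [refine (dv_comp _ (fun u => t + s - u) _ _ D _); repeat dv_step | ].
      intro u; simpl; ring.
    + intros k Hk; now apply dv_mexp.
  - intro u; simpl; rewrite mmul_opp_l, mmul_assoc; ring. }
assert (E := dv_0_const F D 0 s); unfold F in E.
rewrite Rminus_0_r, mexp_0, mmul_idm_r in E by auto.
rewrite E; f_equal; f_equal; ring.
Qed.

Lemma mexp_inv d A t : meq d (mmul d (mexp d A (- t)) (mexp d A t)) idm.
Proof.
intros i j Hi Hj; rewrite <- mexp_plus by auto.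
now rewrite Rplus_opp_l, mexp_0.
Qed.

(** * Piecewise constant trajectories *)

Lemma vnorm_le_rsum d x : vnorm d x <= rsum d (fun i => Rabs (x i)).
Proof.
assert (P : forall n, 0 <= rsum n (fun i => Rabs (x i)))
  by (intro n; apply rsum_nonneg; intros; apply Rabs_pos).
unfold vnorm; rewrite <- (sqrt_Rsqr (rsum d (fun i => Rabs (x i)))) by apply P.
apply sqrt_le_1_alt; unfold Rsqr.
induction d as [ | d IH]; cbn [rsum]; [lra | ].
assert (E : Rabs (x d) * Rabs (x d) = x d ^ 2).
{ rewrite <- Rabs_mult, Rabs_pos_eq by (generalize (Rle_0_sqr (x d)); auto); ring. }
generalize (Rmult_le_pos _ _ (P d) (Rabs_pos (x d))); lra.
Qed.

Lemma entry_le_vnorm d x i : (i < d)%nat -> Rabs (x i) <= vnorm d x.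
Proof.
intro Hi; unfold vnorm; rewrite <- sqrt_Rsqr_abs; apply sqrt_le_1_alt.
replace (x i)² with (x i ^ 2) by (unfold Rsqr; ring).
apply (rsum_term_le d (fun i => x i ^ 2)); auto; intros; apply pow2_ge_0.
Qed.

Lemma derivable_pt_lim_local f g a b t l : a < t < b ->
  (forall s, a < s < b -> f s = g s) ->
  derivable_pt_lim g t l -> derivable_pt_lim f t l.
Proof.
intros Ht E D e He; destruct (D e He) as (delta & H).
assert (P : 0 < Rmin delta (Rmin (t - a) (b - t))).
{ repeat apply Rmin_glb_lt; try lra; apply delta. }
exists (mkposreal _ P); simpl; intros h Nh Hh.
assert (Rabs h < delta) by (apply Rlt_le_trans with (1 := Hh), Rmin_l).
assert (Rabs h < Rmin (t - a) (b - t)) by (apply Rlt_le_trans with (1 := Hh), Rmin_r).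
assert (Rabs h < t - a) by (apply Rlt_le_trans with (2 := Rmin_l (t - a) (b - t)); auto).
assert (H3 : Rabs h < b - t)
  by (apply Rlt_le_trans with (2 := Rmin_r (t - a) (b - t)); auto).
rewrite !E by (try lra; apply Rabs_def2 in H3; apply Rabs_def2 in H2; lra).
apply H; auto.
Qed.

Definition lipschitz_on (a b M : R) (f : R -> R) : Prop :=
  forall s t, a <= s <= b -> a <= t <= b -> Rabs (f s - f t) <= M * Rabs (s - t).

Lemma lipschitz_on_dv f f' f'' a b : dv f f' -> dv f' f'' -> a <= b ->
  exists M, 0 <= M /\ lipschitz_on a b M f.
Proof.
intros D D' ab.
destruct (continuity_ab_maj (fun t => Rabs (f' t)) a b ab) as (p & Hp & _).
{ intros c _; apply (continuity_pt_comp f' Rabs).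
  - exact (dv_continuity _ _ D' c).
  - apply Rcontinuity_abs. }
exists (Rabs (f' p)); split; [apply Rabs_pos | ].
assert (key : forall s t, a <= s -> t <= b -> s < t ->
  Rabs (f t - f s) <= Rabs (f' p) * Rabs (t - s)).
{ intros s t Hs Ht L; destruct (dv_mvt f f' s t D L) as (c & Hc & ->).
  rewrite Rabs_mult; apply Rmult_le_compat_r; [apply Rabs_pos | apply Hp; lra]. }
intros s t Hs Ht; destruct (Rtotal_order s t) as [L | [-> | L]].
- rewrite (Rabs_minus_sym (f s)), (Rabs_minus_sym s); apply key; lra.
- rewrite !Rminus_diag, Rabs_R0; lra.
- apply key; lra.
Qed.

Lemma lipschitz_on_glue a b c M M' f : a <= b <= c -> 0 <= M -> 0 <= M' ->
  lipschitz_on a b M f -> lipschitz_on b c M' f -> lipschitz_on a c (Rmax M M') f.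
Proof.
intros H HM HM' L1 L2.
assert (m1 := Rmax_l M M'); assert (m2 := Rmax_r M M'); set (m := Rmax M M') in *.
assert (key : forall s t, a <= s <= c -> a <= t <= c -> s <= t ->
  Rabs (f s - f t) <= m * (t - s)).
{ intros s t Hs Ht st.
  destruct (Rle_or_lt t b) as [tb | tb].
  - apply Rle_trans with (1 := L1 s t ltac:(lra) ltac:(lra)).
    rewrite Rabs_minus_sym, Rabs_pos_eq by lra; apply Rmult_le_compat_r; lra.
  - destruct (Rle_or_lt b s) as [bs | bs].
    + apply Rle_trans with (1 := L2 s t ltac:(lra) ltac:(lra)).
      rewrite Rabs_minus_sym, Rabs_pos_eq by lra; apply Rmult_le_compat_r; lra.
    + replace (f s - f t) with ((f s - f b) + (f b - f t)) by ring.
      apply Rle_trans with (1 := Rabs_triang _ _).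
      assert (B1 := L1 s b ltac:(lra) ltac:(lra)).
      assert (B2 := L2 b t ltac:(lra) ltac:(lra)).
      rewrite (Rabs_minus_sym s), (Rabs_pos_eq (b - s)) in B1 by lra.
      rewrite (Rabs_minus_sym b), (Rabs_pos_eq (t - b)) in B2 by lra.
      nra. }
intros s t Hs Ht; destruct (Rle_or_lt s t) as [L | L].
- rewrite (Rabs_minus_sym s), (Rabs_pos_eq (t - s)) by lra; apply key; auto.
- rewrite (Rabs_minus_sym (f s)), (Rabs_pos_eq (s - t)) by lra; apply key; auto; lra.
Qed.

Lemma lipschitz_abs_cont d x a b :
  (forall i, (i < d)%nat -> exists M, 0 <= M /\ lipschitz_on a b M (fun t => x t i)) ->
  abs_cont_on d a b x.
Proof.
intro H.
assert (U : exists K, 0 <= K /\ forall s t, a <= s <= b -> a <= t <= b ->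
  rsum d (fun i => Rabs (x s i - x t i)) <= K * Rabs (s - t)).
{ clear - H; induction d as [ | d IH]; simpl.
  - exists 0; split; [lra | intros; lra].
  - destruct IH as (K & HK & BK); [intros; apply H; lia | ].
    destruct (H d ltac:(lia)) as (M & HM & BM).
    exists (K + M); split; [lra | intros s t Hs Ht].
    generalize (BK s t Hs Ht) (BM s t Hs Ht); lra. }
destruct U as (K & HK & BK).
intros e He; exists (e / (K + 1)); split; [apply Rdiv_lt_0_compat; lra | ].
intros l [Hin _] Hl.
apply Rle_lt_trans with (K * fold_right Rplus 0 (map (fun p => snd p - fst p) l)).
- clear Hl; induction l as [ | p l IH]; simpl; [lra | ].
  rewrite Rmult_plus_distr_l; apply Rplus_le_compat.
  + apply Rle_trans with (1 := vnorm_le_rsum _ _).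
    destruct (Hin p (or_introl eq_refl)) as [[H1 H2] H3].
    rewrite <- (Rabs_pos_eq (snd p - fst p)) by lra; apply BK; lra.
  + apply IH; intros q Hq; apply Hin; right; auto.
- set (s := fold_right Rplus 0 _) in *.
  apply Rle_lt_trans with (K * (e / (K + 1))).
  + apply Rmult_le_compat_l; lra.
  + apply (Rmult_lt_reg_r (K + 1)); [lra | ].
    replace (K * (e / (K + 1)) * (K + 1)) with (K * e) by (field; lra); nra.
Qed.

Lemma rsum_geometric e N : rsum N (fun n => e * (1 / 2) ^ n) = 2 * e * (1 - (1 / 2) ^ N).
Proof. induction N as [ | N IH]; simpl; [ring | rewrite IH; field]. Qed.

Lemma rsum_geometric_le e N : 0 <= e -> rsum N (fun n => e * (1 / 2) ^ n) <= 2 * e.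
Proof.
intro He; rewrite rsum_geometric.
assert (0 <= (1 / 2) ^ N) by (apply pow_le; lra); nra.
Qed.

(** The head of the list is the latest segment in time, as the leftmost factor acts last. *)
Fixpoint flow (d : nat) (l : list (R * Mat)) : Mat :=
  match l with nil => idm | p :: l => mmul d (mexp d (snd p) (fst p)) (flow d l) end.

Fixpoint duration (l : list (R * Mat)) : R :=
  match l with nil => 0 | p :: l => fst p + duration l end.

Definition schedule (AA : Mat -> Prop) (l : list (R * Mat)) : Prop :=
  forall p, In p l -> 0 < fst p /\ AA (snd p).

Lemma schedule_app AA l l' : schedule AA l -> schedule AA l' -> schedule AA (l ++ l').
Proof. intros H H' p Hp; apply in_app_or in Hp; destruct Hp; auto. Qed.

Lemma schedule_cons AA t A l : 0 < t -> AA A -> schedule AA l -> schedule AA ((t, A) :: l).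
Proof. intros Ht HA H p [<- | Hp]; auto. Qed.

Lemma duration_app l l' : duration (l ++ l') = duration l + duration l'.
Proof. induction l as [ | p l IH]; simpl; [ring | rewrite IH; ring]. Qed.

Lemma duration_nonneg AA l : schedule AA l -> 0 <= duration l.
Proof.
induction l as [ | p l IH]; simpl; intro H; [lra | ].
generalize (proj1 (H p (or_introl eq_refl))) (IH (fun q Hq => H q (or_intror Hq))); lra.
Qed.

Lemma flow_app d l l' : meq d (flow d (l ++ l')) (mmul d (flow d l) (flow d l')).
Proof.
induction l as [ | p l IH]; intros i j Hi Hj; simpl.
- now rewrite mmul_idm_l.
- rewrite mmul_assoc; apply (meq_mmul d _ _ _ _ (fun _ _ _ _ => eq_refl) IH); auto.
Qed.

Lemma flow_right_inverse d l : exists N, meq d (mmul d (flow d l) N) idm.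
Proof.
induction l as [ | p l (N & HN)]; simpl.
- exists idm; intros i j Hi Hj; now rewrite mmul_idm_l.
- exists (mmul d N (mexp d (snd p) (- fst p))); intros i j Hi Hj.
  rewrite mmul_assoc, <- (mmul_assoc d (flow d l)).
  assert (Hinv := mexp_inv d (snd p) (- fst p)); rewrite Ropp_involutive in Hinv.
  rewrite <- Hinv by auto.
  apply (meq_mmul d _ _ _ _ (fun _ _ _ _ => eq_refl)); auto.
  intros k m Hk Hm; transitivity (mmul d idm (mexp d (snd p) (- fst p)) k m).
  + apply (meq_mmul d _ _ _ _ HN (fun _ _ _ _ => eq_refl)); auto.
  + now apply mmul_idm_l.
Qed.

Lemma dv_mexp_shift d A s F i j : (i < d)%nat ->
  dv (fun t => mmul d (mexp d A (t - s)) F i j)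
     (fun t => mmul d A (mmul d (mexp d A (t - s)) F) i j).
Proof.
intro Hi; eapply dv_eq.
- apply (dv_mmul d (fun t => mexp d A (t - s)) (fun t => mmul d A (mexp d A (t - s)))
    (fun _ => F) (fun _ _ _ => 0)).
  + intros k Hk; assert (D := dv_mexp d A i k Hi).
    eapply dv_eq; [refine (dv_comp _ (fun t => t - s) _ _ D _); repeat dv_step | ].
    intro t; simpl; ring.
  + intros k Hk; apply dv_const.
- intro t; simpl; rewrite mmul_assoc.
  replace (mmul d (mexp d A (t - s)) (fun _ _ => 0) i j) with 0; [ring | ].
  symmetry; apply rsum_0; intros; ring.
Qed.

(** * Trajectories driven by an infinite sequence of segments *)

Section Stream.
Variables (d : nat) (AA : Mat -> Prop) (seg : nat -> R * Mat).
Hypothesis Hseg : forall n, 0 < fst (seg n) /\ AA (snd (seg n)).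

Fixpoint stream_prefix (n : nat) : list (R * Mat) :=
  match n with O => nil | S n => seg n :: stream_prefix n end.

Let T (n : nat) : R := duration (stream_prefix n).
Hypothesis unbounded : forall t, exists n, t < T n.

Lemma switching_time_incr n m : (n <= m)%nat -> T n <= T m.
Proof.
induction 1 as [ | m _ IH]; [lra | ].
unfold T in *; simpl; generalize (proj1 (Hseg m)); lra.
Qed.

Lemma switching_index t : exists n, 0 <= t -> T n <= t < T (S n).
Proof.
destruct (unbounded t) as (m & Hm).
induction m as [ | m IH].
- exists 0%nat; unfold T in Hm; simpl in Hm; lra.
- destruct (Rlt_or_le t (T m)) as [L | L]; [auto | exists m; auto].
Qed.

Lemma switching_index_unique t n m : T n <= t < T (S n) -> T m <= t < T (S m) -> n = m.
Proof.
intros H1 H2; destruct (lt_eq_lt_dec n m) as [[L | ] | L]; auto; exfalso.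
- generalize (switching_time_incr (S n) m L); lra.
- generalize (switching_time_incr (S m) n L); lra.
Qed.

(** The trajectory is column j of the fundamental matrix: on each segment a matrix exponential is
    applied to the value at the preceding switching time. *)
Lemma stream_trajectory j : exists x, trajectory d AA x /\
  forall n i, (i < d)%nat -> x (T n) i = flow d (stream_prefix n) i j.
Proof.
destruct (functional_choice _ switching_index) as (idx & Hidx).
set (piece := fun n t i =>
  mmul d (mexp d (snd (seg n)) (t - T n)) (flow d (stream_prefix n)) i j).
set (x := fun t => piece (idx t) t).
assert (T0 : T 0 = 0) by reflexivity.
assert (Tpos : forall n, 0 <= T n)
  by (intro n; rewrite <- T0; apply switching_time_incr; lia).
assert (TS : forall n, T (S n) = fst (seg n) + T n) by reflexivity.
assert (Tlt : forall n, T n < T (S n))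
  by (intro n; rewrite TS; generalize (proj1 (Hseg n)); lra).
assert (Ei : forall n t, T n <= t < T (S n) -> idx t = n).
{ intros n t Ht; apply (switching_index_unique t); auto.
  apply Hidx; generalize (Tpos n); lra. }
assert (Estart : forall n i, (i < d)%nat -> piece n (T n) i = flow d (stream_prefix n) i j).
{ intros n i Hi; unfold piece; rewrite Rminus_diag, mexp_0; now apply mmul_idm_l. }
assert (Ex : forall n t i, (i < d)%nat -> T n <= t <= T (S n) -> x t i = piece n t i).
{ intros n t i Hi [H1 [H2 | ->]]; unfold x.
  - now rewrite (Ei n).
  - rewrite (Ei (S n)) by (generalize (Tlt (S n)); lra).
    rewrite Estart by auto; unfold piece.
    rewrite TS; replace (fst (seg n) + T n - T n) with (fst (seg n)) by ring; auto. }
assert (Dp : forall n i, (i < d)%nat ->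
  dv (fun t => piece n t i) (fun t => mvec d (snd (seg n)) (piece n t) i))
  by (intros n i Hi; now apply dv_mexp_shift).
exists x; split.
- exists (fun t => snd (seg (idx t))); split; [ | split; [ | split]].
  + intros t _; apply Hseg.
  + intros p q c _ _ e He.
    set (w := fun n : nat => e / 8 * (1 / 2) ^ n).
    assert (Hw : forall n, 0 < w n)
      by (intro n; apply Rmult_lt_0_compat; [lra | apply pow_lt; lra]).
    (* The half-open segments are made open by extending them to the left by w n; the excess lies in
       intervals of total length at most e / 4. *)
    exists (fun t => exists n, c < snd (seg n) p q /\ T n - w n < t < T (S n)).
    split; [ | split].
    * intros t (n & Hn & Ht).
      assert (P : 0 < Rmin (t - (T n - w n)) (T (S n) - t)) by (apply Rmin_glb_lt; lra).
      exists (mkposreal _ P); intros s Hs; unfold disc in Hs; simpl in Hs.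
      assert (H1 : Rabs (s - t) < t - (T n - w n))
        by (apply Rlt_le_trans with (1 := Hs), Rmin_l).
      assert (H2 : Rabs (s - t) < T (S n) - t)
        by (apply Rlt_le_trans with (1 := Hs), Rmin_r).
      apply Rabs_def2 in H1; apply Rabs_def2 in H2.
      exists n; split; auto; lra.
    * intros t [Ht Hc]; exists (idx t); split; auto.
      generalize (Hidx t Ht) (Hw (idx t)); lra.
    * exists (fun n => T n - w n), T; split; [ | split].
      -- intro n; generalize (Hw n); lra.
      -- intros t [(n & Hn & Ht) NE]; exists n; split; [lra | ].
         apply Rnot_le_lt; intro C; apply NE; split; [generalize (Tpos n); lra | ].
         now rewrite (Ei n) by lra.
      -- exists (e / 4); split; [lra | intro N].
         rewrite (rsum_ext N _ w) by (intros; ring).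
         unfold w; apply Rle_trans with (1 := rsum_geometric_le (e / 8) N ltac:(lra)); lra.
  + intros t Ht; apply lipschitz_abs_cont; intros i Hi.
    destruct (unbounded t) as (m & Hm).
    assert (L : exists M, 0 <= M /\ lipschitz_on 0 (T m) M (fun t => x t i)).
    { clear Hm; induction m as [ | m (M & HM & LM)].
      - exists 0; split; [lra | rewrite T0; intros u v Hu Hv].
        replace u with v by lra; rewrite !Rminus_diag, Rabs_R0; lra.
      - destruct (lipschitz_on_dv (fun t => piece m t i) _
          (fun t => mvec d (snd (seg m)) (fun k => mvec d (snd (seg m)) (piece m t) k) i)
          (T m) (T (S m)) (Dp m i Hi)) as (M' & HM' & LM').
        + apply (dv_rsum d (fun k t => snd (seg m) i k * piece m t k)
            (fun k t => snd (seg m) i k * mvec d (snd (seg m)) (piece m t) k)).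
          intros k Hk; assert (D := Dp m k Hk).
          eapply dv_eq;
            [apply (dv_mult (fun _ => snd (seg m) i k)); [apply dv_const | exact D] | ].
          intro u; simpl; ring.
        + generalize (Tlt m); lra.
        + exists (Rmax M M'); split; [apply Rle_trans with (1 := HM), Rmax_l | ].
          apply (lipschitz_on_glue 0 (T m)); auto.
          * split; [apply Tpos | generalize (Tlt m); lra].
          * intros u v Hu Hv; rewrite !(Ex m) by auto; now apply LM'. }
    destruct L as (M & HM & LM); exists M; split; auto.
    intros u v Hu Hv; apply LM; lra.
  + intros e He.
    set (w := fun n : nat => e / 8 * (1 / 2) ^ n).
    assert (Hw : forall n, 0 < w n)
      by (intro n; apply Rmult_lt_0_compat; [lra | apply pow_lt; lra]).
    (* Only the switching times can be exceptional, and 0 is one of them: the left derivative there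
       is unknown. *)
    exists (fun n => T n - w n), (fun n => T n + w n); split; [ | split].
    * intro n; generalize (Hw n); lra.
    * intros t [Ht ND]; destruct (Hidx t Ht) as [H1 H2].
      exists (idx t).
      destruct H1 as [H1 | H1]; [ | rewrite H1; generalize (Hw (idx t)); lra].
      elim ND; intros i Hi.
      apply (derivable_pt_lim_local _ (fun s => piece (idx t) s i) (T (idx t))
               (T (S (idx t)))); [lra | | ].
      -- intros s Hs; apply Ex; auto; lra.
      -- exact (Dp (idx t) i Hi t).
    * exists (e / 2); split; [lra | intro N].
      rewrite (rsum_ext N _ (fun n => 2 * w n)) by (intros; ring).
      rewrite rsum_scal_l.
      generalize (rsum_geometric_le (e / 8) N ltac:(lra)); unfold w; lra.
- intros n i Hi; rewrite (Ex n) by (auto; generalize (Tlt n); lra); auto.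
Qed.
End Stream.

(* Fundamental matrices are invertible, so a fast growing flow can be appended
   to any given one. If no uniform bound existed, concatenating ever faster
   growing flows would therefore give a trajectory violating [exp_bound]. *)
Lemma exp_bound_uniform d AA alpha : exp_bound d AA alpha ->
  exists C, 0 < C /\ forall l, schedule AA l ->
    entry_sum d (flow d l) <= C * exp (alpha * duration l).
Proof.
intro HB; apply NNPP; intro Hno.
assert (Hbig : forall C, 0 < C -> exists l, schedule AA l /\
  C * exp (alpha * duration l) < entry_sum d (flow d l)).
{ intros C HC; apply NNPP; intro N; apply Hno; exists C; split; auto.
  intros l Hl; apply Rnot_lt_le; intro L; apply N; exists l; auto. }
clear Hno.
assert (HA : exists A, AA A).
{ assert (P := entry_sum_nonneg d idm).
  destruct (Hbig (entry_sum d idm + 1) ltac:(lra)) as ([ | p l] & Hl & L).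
  - simpl in L; rewrite Rmult_0_r, exp_0 in L; lra.
  - exists (snd p); apply (Hl p); left; auto. }
destruct HA as (A0 & HA0).
(* The inserted segment (1, A0) makes length and duration grow by at least 1 at each stage, so the
   limiting stream covers all times. *)
assert (Hstep : forall lk : list (R * Mat) * nat, exists b, schedule AA (fst lk) ->
  let l' := b ++ (1, A0) :: fst lk in schedule AA l' /\
  INR (snd lk) * exp (alpha * duration l') <= entry_sum d (flow d l')).
{ intros [l k]; simpl.
  destruct (classic (schedule AA l)) as [Hl | Hl]; [ | exists nil; tauto].
  set (l1 := (1, A0) :: l).
  assert (Hl1 : schedule AA l1) by (apply schedule_cons; auto; lra).
  destruct (flow_right_inverse d l1) as (N & HN).
  (* N recovers the flow of b from that of b ++ l1. If the former exceeds c exp (alpha * duration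
     b), the latter must therefore be as large as required. *)
  set (c := INR k * exp (alpha * duration l1) * entry_sum d N).
  assert (Hc : 0 <= c).
  { apply Rmult_le_pos; [apply Rmult_le_pos; [apply pos_INR | left; apply exp_pos] |
      apply entry_sum_nonneg]. }
  destruct (Hbig (c + 1) ltac:(lra)) as (b & Hb & L).
  exists b; intros _; split; [now apply schedule_app | ].
  apply Rnot_lt_le; intro C.
  assert (E : meq d (flow d b) (mmul d (flow d (b ++ l1)) N)).
  { intros i j Hi Hj.
    transitivity (mmul d (mmul d (flow d b) (flow d l1)) N i j).
    - rewrite mmul_assoc; transitivity (mmul d (flow d b) idm i j);
        [now rewrite mmul_idm_r | ].
      apply (meq_mmul d _ _ _ _ (fun _ _ _ _ => eq_refl)); auto.
      intros u v Hu Hv; symmetry; auto.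
    - apply meq_mmul; auto; [ | intros u v _ _; auto].
      intros u v Hu Hv; symmetry; now apply flow_app. }
  assert (B : entry_sum d (flow d b) <= entry_sum d (flow d (b ++ l1)) * entry_sum d N).
  { rewrite (entry_sum_meq _ _ _ E); apply entry_sum_mmul_le. }
  rewrite duration_app, Rmult_plus_distr_l, exp_plus in C.
  assert (Pe := exp_pos (alpha * duration b)).
  assert (entry_sum d (flow d (b ++ l1)) * entry_sum d N <= exp (alpha * duration b) * c).
  { unfold c; replace (exp (alpha * duration b) *
      (INR k * exp (alpha * duration l1) * entry_sum d N)) with
      (INR k * (exp (alpha * duration b) * exp (alpha * duration l1)) * entry_sum d N)
      by ring.
    apply Rmult_le_compat_r; [apply entry_sum_nonneg | lra]. }
  nra. }
apply functional_choice in Hstep; destruct Hstep as (step & Hstep).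
set (st := fix st k := match k with
  | O => nil | S k => step (st k, S k) ++ (1, A0) :: st k end).
assert (stS : forall k, st (S k) = step (st k, S k) ++ (1, A0) :: st k) by reflexivity.
assert (Hst : forall k, schedule AA (st k)).
{ induction k as [ | k IH]; [intros p [] | apply (Hstep (st k, S k) IH)]. }
assert (Hgrow : forall k,
  INR k * exp (alpha * duration (st k)) <= entry_sum d (flow d (st k))).
{ intros [ | k]; [simpl INR; rewrite Rmult_0_l; apply entry_sum_nonneg | ].
  apply (Hstep (st k, S k) (Hst k)). }
assert (Hlen : forall k, (k <= length (st k))%nat).
{ induction k as [ | k IH]; [simpl; lia | rewrite stS, length_app; simpl; lia]. }
assert (Hdur : forall k, INR k <= duration (st k)).
{ induction k as [ | k IH]; [simpl; lra | ].
  rewrite S_INR, stS, duration_app; simpl.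
  assert (Hs : schedule AA (step (st k, S k))).
  { intros p Hp; apply (proj1 (Hstep (st k, S k) (Hst k))), in_or_app; auto. }
  generalize (duration_nonneg AA _ Hs); lra. }
assert (Hext : forall k m, (k <= m)%nat -> exists b, st m = b ++ st k).
{ induction 1 as [ | m _ (b & IH)]; [exists nil; auto | ].
  exists (step (st m, S m) ++ (1, A0) :: b).
  rewrite stS, IH at 1; rewrite <- app_assoc; f_equal; now rewrite IH. }
(* Each st k is a suffix of the later ones, so counting from the end gives a consistent stream; st
   (S i) has more than i segments, so the default is never returned. *)
set (seg := fun i => nth i (rev (st (S i))) (1, A0)).
assert (Hnth : forall k i, (i < length (st k))%nat -> nth i (rev (st k)) (1, A0) = seg i).
{ assert (key : forall k m i, (k <= m)%nat -> (i < length (st k))%nat ->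
    nth i (rev (st k)) (1, A0) = nth i (rev (st m)) (1, A0)).
  { intros k m i Hkm Hi; destruct (Hext k m Hkm) as (b & ->).
    rewrite rev_app_distr, app_nth1; auto; now rewrite length_rev. }
  intros k i Hi; unfold seg; destruct (le_lt_dec k (S i)) as [L | L].
  - now apply key.
  - symmetry; apply key; [lia | apply Hlen]. }
assert (Hpre : forall k, st k = stream_prefix seg (length (st k))).
{ intro k.
  assert (R : forall n, rev (stream_prefix seg n) = map seg (List.seq 0 n)).
  { induction n as [ | n IH]; auto.
    simpl rev; rewrite IH, seq_S, map_app; auto. }
  rewrite <- (rev_involutive (st k)), <- (rev_involutive (stream_prefix seg _)).
  f_equal; rewrite R, length_rev, length_rev.
  apply nth_ext with (1, A0) (seg 0%nat).
  - now rewrite length_rev, length_map, length_seq.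
  - intros i Hi; rewrite length_rev in Hi.
    rewrite map_nth, seq_nth by auto; now apply Hnth. }
assert (Hseg : forall n, 0 < fst (seg n) /\ AA (snd (seg n))).
{ intro n; apply (Hst (S n)), in_rev, nth_In.
  rewrite length_rev; apply Hlen. }
assert (Hunb : forall t, exists n, t < duration (stream_prefix seg n)).
{ intro t; destruct (INR_unbounded t) as (k & Hk).
  exists (length (st k)); rewrite <- Hpre; generalize (Hdur k); lra. }
assert (Hcol : forall j, exists C, forall k i, (i < d)%nat ->
  Rabs (flow d (st k) i j) <= C * exp (alpha * duration (st k))).
{ intro j; destruct (stream_trajectory d AA seg Hseg Hunb j) as (x & Tx & Ex).
  destruct (HB x Tx) as (C & HC); exists C; intros k i Hi.
  rewrite Hpre, <- Ex by auto.
  apply Rle_trans with (1 := entry_le_vnorm d _ i Hi), HC.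
  rewrite <- Hpre; apply (duration_nonneg AA), Hst. }
apply functional_choice in Hcol; destruct Hcol as (C & HC).
(* The constants of the d column trajectories together bound every flow (st k), while stage k was
   built to exceed factor k. *)
destruct (INR_unbounded (rsum d (fun _ => rsum d C))) as (k & Hk).
assert (B : entry_sum d (flow d (st k)) <=
  rsum d (fun _ => rsum d C) * exp (alpha * duration (st k))).
{ unfold entry_sum; rewrite <- rsum_scal_r; apply rsum_le; intros i Hi.
  rewrite <- rsum_scal_r; apply rsum_le; intros j Hj; now apply HC. }
generalize (Hgrow k) (exp_pos (alpha * duration (st k))); nra.
Qed.

(** * Real spectra and the Cayley-Hamilton theorem *)

Definition vshift (d : nat) (A : Mat) (v : Vec) (a : R) : Vec :=
  fun i => mvec d A v i - a * v i.

Module CayleyHamilton.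
Import all_boot all_algebra complex Rstruct.
Import GRing.Theory Num.Theory.
Local Open Scope ring_scope.

Lemma rsum_big d (f : nat -> R) : rsum d f = \sum_(i < d) f i.
Proof. by elim: d => [|d IH] /=; rewrite ?big_ord0 // big_ord_recr /= IH. Qed.

Section Matrix.
Variables (n : nat) (A : Mat).
Let d := n.+1.
(** The transpose of A, because vectors become rows multiplied on the left. *)
Let M : 'M[R]_d := \matrix_(i, j) A j i.
Let C : 'M[R[i]]_d := map_mx (real_complex R) M.

Definition rowv (v : Vec) : 'rV[R]_d := \row_i v i.

Lemma rowv_vshift v a : rowv (vshift d A v a) = rowv v *m (M - a%:M).
Proof.
rewrite mulmxBr mul_mx_scalar; apply/rowP => i.
rewrite !mxE /vshift /mvec rsum_big; congr (_ - _).
by apply: eq_bigr => k _; rewrite !mxE mulrC.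
Qed.

Lemma rowv_fold_vshift s v :
  rowv (fold_left (vshift d A) s v) = rowv v *m \prod_(a <- s) (M - a%:M).
Proof.
elim: s v => [|a s IH] v /=; first by rewrite big_nil mulmx1.
by rewrite IH rowv_vshift big_cons mulmxA.
Qed.

Lemma root_is_eigenvalue (z : R[i]) : root (char_poly C) z ->
  is_eigenvalue d A (complex.Re z) (complex.Im z).
Proof.
rewrite -eigenvalue_root_char => /eigenvalueP [v Ev Nv].
pose u (k : nat) : R[i] := if insub k is Some i then v 0 (i : 'I_d) else 0.
have uE (i : 'I_d) : u i = v 0 i by rewrite /u valK.
exists (fun k => complex.Re (u k)), (fun k => complex.Im (u k)); split.
  case/rV0Pn: Nv => i Ni; exists i; split; first exact/ltP.
  rewrite uE; case: (v 0 i) Ni => a b /= Ni.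
  case: (eqVneq a 0) => [a0|/eqP]; last by left.
  right => b0; move: Ni; rewrite a0 b0; by rewrite eqxx.
move=> k /ltP lt_kd; rewrite -[k]/(nat_of_ord (Ordinal lt_kd)).
move: (Ordinal lt_kd) => i {k lt_kd}.
have := congr1 (fun w : 'rV[R[i]]_d => w 0 i) Ev; rewrite !mxE.
rewrite /mvec !rsum_big -uE => E.
have Es : \sum_(j < d) (A i j)%:C%C * u j = z * u i.
  by rewrite -E; apply: eq_bigr => j _; rewrite !mxE uE mulrC.
have Re_sum (F : 'I_d -> R[i]) : complex.Re (\sum_j F j) = \sum_j complex.Re (F j).
  by elim/big_rec2: _ => // j a b _ <-; case: (F j) b => ? ? [].
have Im_sum (F : 'I_d -> R[i]) : complex.Im (\sum_j F j) = \sum_j complex.Im (F j).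
  by elim/big_rec2: _ => // j a b _ <-; case: (F j) b => ? ? [].
split.
  transitivity (complex.Re (z * u i)); last by case: z {E Es Ev} => a b; case: (u i).
  rewrite -Es Re_sum; apply: eq_bigr => j _.
  by case: (u j) => a b /=; rewrite mul0r subr0.
transitivity (complex.Im (z * u i)).
  rewrite -Es Im_sum; apply: eq_bigr => j _.
  by case: (u j) => a b /=; rewrite mul0r addr0.
by case: z {E Es Ev} => a b; case: (u i) => e f /=; rewrite addrC.
Qed.

(** The characteristic polynomial splits over the complex numbers. Its roots are eigenvalues, hence
    real, so it already splits over R and Cayley-Hamilton turns into a product of factors A - a. *)
Lemma real_spectrum_annihilates : only_real_eigenvalues d A ->
  exists s : list R, length s = d /\
    (forall a, List.In a s -> is_eigenvalue d A a 0) /\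
    (forall v i, (i < d)%coq_nat -> fold_left (vshift d A) s v i = 0).
Proof.
move=> Hr.
have [r Er] := closed_field_poly_normal (char_poly C).
rewrite (monicP (char_poly_monic _)) scale1r in Er.
have Hroot z : z \in r -> root (char_poly C) z by rewrite Er root_prod_XsubC.
have realr z : z \in r -> z = (complex.Re z)%:C%C.
  move=> /Hroot /root_is_eigenvalue /Hr; by case: z => a b /= ->.
pose s := [seq complex.Re z | z <- r].
have Es : char_poly M = \prod_(a <- s) ('X - a%:P).
  apply: (map_poly_inj (real_complex R)).
  rewrite map_char_poly -/C Er rmorph_prod big_map.
  rewrite [LHS]big_seq [RHS]big_seq; apply: eq_bigr => z /realr Ez.
  by rewrite rmorphB /= map_polyX map_polyC /= {1}Ez.
exists s; split; [|split].
- have := size_char_poly M; rewrite Es size_prod_XsubC => -[] <-.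
  by elim: (s) => //= a l ->.
- move=> a Ha.
  have {Ha} : a \in s by elim: (s) Ha => //= b l IH [->|/IH];
    rewrite inE ?eqxx // => ->; rewrite orbT.
  case/mapP => z zr ->.
  have := root_is_eigenvalue z (Hroot z zr).
  by rewrite (realr z zr) /=.
- move=> v i /ltP lt_id.
  have := Cayley_Hamilton M; rewrite Es rmorph_prod.
  under eq_bigr => a _ do rewrite rmorphB /= horner_mx_X horner_mx_C.
  move=> E; have := congr1 (fun w : 'rV[R]_d => w 0 (Ordinal lt_id)) (rowv_fold_vshift s v).
  by rewrite E mulmx0 !mxE.
Qed.
End Matrix.
End CayleyHamilton.

Lemma real_spectrum_annihilates d A : only_real_eigenvalues d A ->
  exists s : list R, length s = d /\
    (forall a, In a s -> is_eigenvalue d A a 0) /\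
    (forall v i, (i < d)%nat -> fold_left (vshift d A) s v i = 0).
Proof.
destruct d as [ | n]; intro H.
- exists nil; split; [auto | split].
  + intros a [].
  + intros v i Hi; inversion Hi.
- exact (CayleyHamilton.real_spectrum_annihilates n A H).
Qed.

(** * Products of Euler steps *)

Lemma argmax_Rabs n (v : nat -> R) : exists i, (i < S n)%nat /\
  forall k, (k < S n)%nat -> Rabs (v k) <= Rabs (v i).
Proof.
induction n as [ | n (i & Hi & M)].
- exists 0%nat; split; [lia | intros k Hk; replace k with 0%nat by lia; lra].
- destruct (Rle_or_lt (Rabs (v (S n))) (Rabs (v i))) as [L | L].
  + exists i; split; [lia | intros k Hk].
    destruct (Nat.eq_dec k (S n)) as [-> | N]; [auto | apply M; lia].
  + exists (S n); split; [lia | intros k Hk].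
    destruct (Nat.eq_dec k (S n)) as [-> | N]; [lra | ].
    apply Rle_trans with (Rabs (v i)); [apply M; lia | lra].
Qed.

Lemma real_eigenvector d A a : is_eigenvalue d A a 0 ->
  exists v : Vec, (exists i, (i < d)%nat /\ v i <> 0) /\
    forall i, (i < d)%nat -> mvec d A v i = a * v i.
Proof.
intros (u & w & (i & Hi & [N | N]) & E).
- exists u; split; [exists i; auto | intros k Hk; rewrite (proj1 (E k Hk)); ring].
- exists w; split; [exists i; auto | intros k Hk; rewrite (proj2 (E k Hk)); ring].
Qed.

(** Compare both sides of A v = a v at a coordinate of largest modulus. *)
Lemma real_eigenvalue_bound d A a : is_eigenvalue d A a 0 -> Rabs a <= entry_sum d A.
Proof.
intro H; destruct (real_eigenvector d A a H) as (v & (i0 & Hi0 & N0) & E).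
destruct d as [ | n]; [lia | ].
destruct (argmax_Rabs n v) as (i & Hi & M).
assert (P : 0 < Rabs (v i)).
{ apply Rlt_le_trans with (Rabs (v i0)); [now apply Rabs_pos_lt | now apply M]. }
apply (Rmult_le_reg_r (Rabs (v i))); auto.
rewrite <- Rabs_mult, <- E by auto.
exact (mmul_entry_bound (S n) A (fun k _ => v k) (Rabs (v i)) i 0 Hi M).
Qed.

(** The hypothesis speaks only of suprema that exist; boundedness of the moduli by [entry_sum]
    supplies one. *)
Lemma real_eigenvalue_le_radius d A r a : only_real_eigenvalues d A ->
  (forall rho, spectral_radius_is d A rho -> rho <= r) ->
  is_eigenvalue d A a 0 -> Rabs a <= r.
Proof.
intros Hreal Hrho Ha.
set (moduli := fun m => exists a b, is_eigenvalue d A a b /\ m = sqrt (a ^ 2 + b ^ 2)).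
assert (Em : forall a, sqrt (a ^ 2 + 0 ^ 2) = Rabs a).
{ intro x; rewrite <- sqrt_Rsqr_abs; f_equal; unfold Rsqr; ring. }
destruct (completeness moduli) as (rho & Hl).
- exists (entry_sum d A); intros m (x & b & Hx & ->).
  assert (b = 0) by exact (Hreal x b Hx); subst b; rewrite Em.
  now apply real_eigenvalue_bound.
- exists (Rabs a), a, 0; now rewrite Em.
- apply Rle_trans with rho; [ | now apply Hrho].
  apply (proj1 Hl); exists a, 0; now rewrite Em.
Qed.

Lemma mexp_eigenvector d A a v : (forall i, (i < d)%nat -> mvec d A v i = a * v i) ->
  forall t i, (i < d)%nat -> mvec d (mexp d A t) v i = exp (a * t) * v i.
Proof.
intros E t i Hi.
assert (D : dv (fun t => mvec d (mexp d A t) v i)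
               (fun t => a * mvec d (mexp d A t) v i)).
{ eapply dv_eq.
  - apply (dv_rsum d (fun k t => mexp d A t i k * v k)
      (fun k t => mmul d (mexp d A t) A i k * v k)).
    intros k Hk; assert (D := dv_mexp_r d A i k Hi Hk).
    eapply dv_eq; [apply (dv_mult _ (fun _ => v k)); [exact D | apply dv_const] | ].
    intro u; simpl; ring.
  - intro u.
    change (mmul d (mmul d (mexp d A u) A) (fun k _ => v k) i 0%nat
      = a * mvec d (mexp d A u) v i).
    rewrite mmul_assoc; unfold mmul at 1, mvec; rewrite <- rsum_scal_l.
    apply rsum_ext; intros k Hk.
    change (mmul d A (fun k _ => v k) k 0%nat) with (mvec d A v k).
    rewrite E by auto; ring. }
assert (D' : dv (fun t => mvec d (mexp d A t) v i)
               (fun t => - - a * mvec d (mexp d A t) v i)).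
{ eapply dv_eq; [exact D | intro; simpl; ring]. }
rewrite (exp_ode_const (- a) _ D' t 0).
replace (mvec d (mexp d A 0) v i) with (v i).
- replace (- - a * (t - 0)) with (a * t) by ring; ring.
- rewrite mexp_0; symmetry; exact (rsum_delta d i v Hi).
Qed.

(** Along an eigenvector the flow grows like exp (a t), which the uniform bound forbids when a >
    alpha. *)
Lemma eigenvalue_le_exp_bound d AA alpha A a : exp_bound d AA alpha -> AA A ->
  is_eigenvalue d A a 0 -> a <= alpha.
Proof.
intros HB HA Ha; apply Rnot_lt_le; intro L.
destruct (exp_bound_uniform d AA alpha HB) as (C & HC & U).
destruct (real_eigenvector d A a Ha) as (v & (i & Hi & Ni) & E).
assert (Pv : 0 < Rabs (v i)) by now apply Rabs_pos_lt.
set (w := rsum d (fun k => Rabs (v k))).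
assert (Hw : 0 <= w) by (apply rsum_nonneg; intros; apply Rabs_pos).
assert (B : forall t, 0 < t -> exp ((a - alpha) * t) * Rabs (v i) <= C * w).
{ intros t Ht.
  assert (Hs : schedule AA ((t, A) :: nil)) by (apply schedule_cons; auto; intros p []).
  assert (B := U _ Hs); simpl in B; rewrite Rplus_0_r in B.
  assert (Eq : meq d (mmul d (mexp d A t) idm) (mexp d A t))
    by (intros p q _ Hq; now apply mmul_idm_r).
  rewrite (entry_sum_meq _ _ _ Eq) in B.
  assert (B' : Rabs (mvec d (mexp d A t) v i) <= C * exp (alpha * t) * w).
  { apply Rle_trans with (1 := rsum_Rabs _ _).
    unfold w; rewrite <- rsum_scal_l; apply rsum_le; intros k Hk.
    rewrite Rabs_mult; apply Rmult_le_compat_r; [apply Rabs_pos | ].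
    apply Rle_trans with (2 := B); now apply entry_le_entry_sum. }
  rewrite (mexp_eigenvector d A a v E) in B' by auto.
  rewrite Rabs_mult, (Rabs_pos_eq (exp _)) in B' by (left; apply exp_pos).
  assert (Pe := exp_pos (alpha * t)).
  apply (Rmult_le_reg_l (exp (alpha * t))); auto.
  rewrite <- Rmult_assoc, <- exp_plus.
  replace (alpha * t + (a - alpha) * t) with (a * t) by ring; lra. }
(* At this time exp ((a - alpha) t) >= 1 + (a - alpha) t already exceeds C w / |v i|. *)
set (t := (C * w / Rabs (v i) + 1) / (a - alpha)).
assert (Ht : (a - alpha) * t = C * w / Rabs (v i) + 1) by (unfold t; field; lra).
assert (H0 : 0 <= C * w / Rabs (v i)).
{ apply Rmult_le_pos; [apply Rmult_le_pos; lra | left; now apply Rinv_0_lt_compat]. }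
assert (Pt : 0 < t) by (apply Rdiv_lt_0_compat; lra).
assert (Bt := B t Pt); rewrite Ht in Bt.
assert (X := exp_ineq1_le (C * w / Rabs (v i) + 1)).
assert (C * w / Rabs (v i) * Rabs (v i) = C * w) by (field; lra).
nra.
Qed.

(* [mexp d A t] solves X' = A X and prod (A - a) = 0, so the entries of
   exp (beta t) Q exp (t A) X are exponential polynomials. *)
Lemma mexp_entry_sol d A beta s (Q X : Mat) i j :
  (forall v k, (k < d)%nat -> fold_left (vshift d A) s v k = 0) ->
  sol (map (fun a => - (a + beta)) s)
    (fun t => exp (beta * t) * mmul d Q (mmul d (mexp d A t) X) i j).
Proof.
intro H.
assert (Hf : forall k, (k < d)%nat ->
  fold_left (vshift d A) s (fun k => X k j) k = 0) by auto.
clear H.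
(* D F(x) = beta F(x) + F(A x), so D - (a + beta) maps F(x) to F((A - a) x): the operators act as
   shifts of A on the initial vector. *)
set (F := fun (x : Vec) t => exp (beta * t) *
  rsum d (fun k => Q i k * mvec d (mexp d A t) x k)).
change (sol (map (fun a => - (a + beta)) s) (F (fun k => X k j))).
generalize dependent (fun k => X k j); intros x Hx.
revert x Hx; induction s as [ | a s IH]; simpl; intros x Hx.
- unfold sol; simpl; extensionality t; unfold F.
  rewrite (rsum_0 d); [ring | intros k Hk].
  unfold mvec; rewrite rsum_0; [ring | intros l Hl; rewrite Hx by auto; ring].
- exists (F (vshift d A x a)); split; [ | now apply IH].
  assert (De : dv (fun t => exp (beta * t)) (fun t => beta * exp (beta * t))) by dv_auto.
  assert (Dx : forall k, (k < d)%nat ->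
    dv (fun t => mvec d (mexp d A t) x k) (fun t => mvec d (mexp d A t) (mvec d A x) k)).
  { intros k Hk; eapply dv_eq.
    - apply (dv_rsum d (fun l t => mexp d A t k l * x l)
        (fun l t => mmul d (mexp d A t) A k l * x l)).
      intros l Hl; assert (D := dv_mexp_r d A k l Hk Hl).
      eapply dv_eq; [apply (dv_mult _ (fun _ => x l)); [exact D | apply dv_const] | ].
      intro u; simpl; ring.
    - intro u.
      change (mmul d (mmul d (mexp d A u) A) (fun k _ => x k) k 0%nat
        = mmul d (mexp d A u) (mmul d A (fun k _ => x k)) k 0%nat).
      now rewrite mmul_assoc. }
  unfold F; eapply dv_eq.
  + apply (dv_mult (fun t => exp (beta * t))); [exact De | ].
    apply (dv_rsum d (fun k t => Q i k * mvec d (mexp d A t) x k)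
      (fun k t => Q i k * mvec d (mexp d A t) (mvec d A x) k)).
    intros k Hk; assert (D := Dx k Hk).
    eapply dv_eq; [apply (dv_mult (fun _ => Q i k)); [apply dv_const | exact D] | ].
    intro u; simpl; ring.
  + intro t; simpl.
    rewrite (rsum_ext d (fun k => Q i k * mvec d (mexp d A t) (vshift d A x a) k)
      (fun k => Q i k * mvec d (mexp d A t) (mvec d A x) k
        + - a * (Q i k * mvec d (mexp d A t) x k))).
    * rewrite rsum_plus, rsum_scal_l; ring.
    * intros k Hk; unfold mvec at 1, vshift.
      rewrite (rsum_ext d _ (fun l => mexp d A t k l * mvec d A x l
        + - a * (mexp d A t k l * x l))) by (intros; ring).
      rewrite rsum_plus, rsum_scal_l; unfold mvec; ring.
Qed.

(* With s = tau / (1 - tau beta), the Taylor expansion of [g] at 0 evaluates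
   (1 - tau beta) g(0) + tau g'(0) as (1 - tau beta) (g(s) - s^2 g''(xi) / 2);
   Markov's inequality bounds the remainder. When [l] has a single element,
   g' = - h g and the left-hand side is explicit. *)
Lemma euler_step_contraction r eps tau beta m : 0 < r -> 0 < eps -> 0 < tau ->
  eps < beta <= r -> (0 < m)%nat ->
  tau < 6 * eps / ((16 * INR m ^ 2 - 24 * INR m + 11) * r ^ 2) ->
  exists q, 0 < q < 1 /\ forall l g g' K, length l = m ->
    (forall h, In h l -> 0 < h <= r - beta) ->
    sol l g -> dv g g' -> 0 < K -> (forall t, 0 <= t -> Rabs (g t) <= K) ->
    Rabs ((1 - tau * beta) * g 0 + tau * g' 0) <= q * K.
Proof.
intros Hr Heps Htau Hb Hm Hlt.
set (c := (16 * INR m ^ 2 - 24 * INR m + 11) / 3).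
(* c is 1 for m = 1 and 9 for m = 2; the general argument uses c >= 9 to absorb beta^2. *)
assert (Hcases : m = 1%nat \/ 9 <= c).
{ destruct m as [ | [ | n]]; [lia | auto | right].
  unfold c; rewrite !S_INR; generalize (pos_INR n); nra. }
assert (Hc : 1 <= c) by (destruct Hcases as [-> | ]; [unfold c; simpl; lra | lra]).
assert (Hr2 : 0 < r ^ 2) by (apply pow_lt; auto).
assert (Ht : tau * (c * r ^ 2) < 2 * eps).
{ replace (16 * INR m ^ 2 - 24 * INR m + 11) with (3 * c) in Hlt by (unfold c; field).
  assert (P : 0 < 3 * c * r ^ 2) by nra.
  apply (Rmult_lt_compat_r _ _ _ P) in Hlt.
  replace (6 * eps / (3 * c * r ^ 2) * (3 * c * r ^ 2)) with (6 * eps) in Hlt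
    by (field; nra).
  lra. }
assert (Htr : tau * r < 2).
{ apply (Rmult_lt_reg_r r); auto; apply Rle_lt_trans with (tau * (c * r ^ 2)); [ | lra].
  replace (tau * r * r) with (tau * (1 * r ^ 2)) by ring.
  apply Rmult_le_compat_l; [lra | apply Rmult_le_compat_r; lra]. }
destruct Hcases as [Hm1 | Hc9].
(* The step multiplies g 0 by 1 - tau (beta + h), where beta < beta + h <= r and tau r < 2. *)
- set (q := Rmax (1 / 2) (Rmax (1 - tau * beta) (tau * r - 1))).
  assert (q1 := Rmax_l (1 / 2) (Rmax (1 - tau * beta) (tau * r - 1))).
  assert (q2 := Rmax_r (1 / 2) (Rmax (1 - tau * beta) (tau * r - 1))).
  assert (q3 := Rmax_l (1 - tau * beta) (tau * r - 1)).
  assert (q4 := Rmax_r (1 - tau * beta) (tau * r - 1)).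
  fold q in q1, q2.
  assert (0 < tau * beta) by (apply Rmult_lt_0_compat; lra).
  exists q; split; [split; [lra | unfold q; repeat apply Rmax_lub_lt; lra] | ].
  intros l g g' K Hl Pos Sg Dg HK B.
  destruct l as [ | h [ | h' l]]; try (simpl in Hl; lia).
  destruct Sg as (g1 & D1 & E1); simpl in E1; subst g1.
  rewrite (dv_unique _ _ _ Dg D1).
  destruct (Pos h (or_introl eq_refl)) as [h1 h2].
  replace ((1 - tau * beta) * g 0 + tau * (0 - h * g 0))
    with ((1 - tau * (beta + h)) * g 0) by ring.
  rewrite Rabs_mult; apply Rmult_le_compat; try apply Rabs_pos; [ | apply B; lra].
  assert (tau * h <= tau * (r - beta)) by (apply Rmult_le_compat_l; lra).
  assert (0 < tau * h) by (apply Rmult_lt_0_compat; lra).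
  apply Rabs_le; lra.
- set (R := r - beta) in *.
  (* As beta <= r, passing from r^2 to (r - beta)^2 saves 2 beta r - beta^2 >= beta^2; times c / 2
     this outweighs beta^2. *)
  assert (Hkey : tau * (c * R ^ 2 / 2 + beta ^ 2) < beta).
  { apply Rle_lt_trans with (tau * (c * r ^ 2) / 2); [ | lra].
    replace (tau * (c * r ^ 2) / 2) with (tau * (c * r ^ 2 / 2)) by field.
    apply Rmult_le_compat_l; [lra | ].
    unfold R; assert (2 * (beta * r) - beta ^ 2 >= beta ^ 2) by nra.
    assert (c * (2 * (beta * r) - beta ^ 2) >= 9 * beta ^ 2) by nra.
    nra. }
  assert (Htb : tau * beta < 1).
  { apply (Rmult_lt_reg_r beta); [lra | ].
    assert (0 <= tau * (c * R ^ 2 / 2))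
      by (apply Rmult_le_pos; [lra | generalize (pow2_ge_0 R); nra]).
    lra. }
  set (p := 1 - tau * beta) in *.
  assert (Hp : 0 < p) by (unfold p; lra).
  set (s := tau / p).
  assert (Hs : 0 < s) by (apply Rdiv_lt_0_compat; auto).
  assert (Hsp : p * s = tau) by (unfold s; field; lra).
  set (q := p * (1 + s ^ 2 / 2 * (c * R ^ 2))).
  assert (Hq : 0 < q < 1).
  { assert (0 <= s ^ 2 / 2 * (c * R ^ 2)).
    { generalize (pow2_ge_0 s) (pow2_ge_0 R); intros;
      apply Rmult_le_pos; [lra | apply Rmult_le_pos; lra]. }
    split; [unfold q; apply Rmult_lt_0_compat; lra | ].
    (* Since p = 1 - tau beta, the inequality p q < p is exactly tau times [Hkey]. *)
    assert (E : p * q = p * p + tau * tau * (c * R ^ 2 / 2))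
      by (unfold q; rewrite <- Hsp; field).
    apply (Rmult_lt_reg_l p); auto; rewrite E, Rmult_1_r.
    assert (p * p = p - tau * beta + tau * beta * (tau * beta)) by (unfold p; ring).
    assert (tau * (tau * (c * R ^ 2 / 2 + beta ^ 2)) < tau * beta)
      by (apply Rmult_lt_compat_l; auto).
    lra. }
  exists q; split; auto.
  intros l g g' K Hl Pos Sg Dg HK B.
  destruct (sol_dv l g' (sol_dv_eq _ _ _ Sg Dg)) as (g2 & Dg' & _).
  assert (Nl : l <> nil) by (intros ->; simpl in Hl; lia).
  assert (HR : 0 < R).
  { destruct l as [ | h l]; [now elim Nl | ].
    generalize (Pos h (or_introl eq_refl)); lra. }
  assert (M : forall u, 0 <= u -> Rabs (g2 u) <= K * (c * R ^ 2)).
  { intros u Hu.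
    assert (M := exponential_markov l R K g g' g2 u Nl HR Pos Sg Dg Dg' HK Hu B).
    rewrite Hl in M; exact M. }
  set (b := K * (c * R ^ 2)) in *.
  (* Taylor's formula as monotonicity in u: moving the base point from 0 to s, the quadratic term
     compensates the bound b on g2. *)
  assert (DT : forall sg,
    dv (fun u => sg * (g u + (s - u) * g' u) - b * ((s - u) * (s - u) / 2))
    (fun u => (s - u) * (sg * g2 u + b))).
  { intro sg; unfold Rdiv; dv_auto; field. }
  assert (key : forall sg, sg = 1 \/ sg = -1 ->
    sg * (g 0 + s * g' 0) <= K + b * (s ^ 2 / 2)).
  { intros sg Hsg.
    assert (Mono := dv_nondecreasing _ _ 0 s (DT sg) ltac:(lra)); simpl in Mono.
    assert (Bs := B s ltac:(lra)).
    assert (sg * g s <= K).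
    { apply Rabs_le_between in Bs; destruct Hsg as [-> | ->]; lra. }
    assert (sg * (g 0 + (s - 0) * g' 0) - b * ((s - 0) * (s - 0) / 2)
      <= sg * (g s + (s - s) * g' s) - b * ((s - s) * (s - s) / 2)).
    { apply Mono; intros u Hu; apply Rmult_le_pos; [lra | ].
      assert (M' := M u ltac:(lra)); apply Rabs_le_between in M'.
      destruct Hsg as [-> | ->]; lra. }
    replace (s - s) with 0 in * by ring; lra. }
  assert (K1 := key 1 (or_introl eq_refl)); assert (K2 := key (-1) (or_intror eq_refl)).
  replace (p * g 0 + tau * g' 0) with (p * (g 0 + s * g' 0)) by (rewrite <- Hsp; ring).
  rewrite Rabs_mult, (Rabs_pos_eq p) by lra.
  replace (q * K) with (p * (K + b * (s ^ 2 / 2))) by (unfold q, b; ring).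
  apply Rmult_le_compat_l; [lra | apply Rabs_le; lra].
Qed.

Lemma mmul_madd_scal d (Q X A : Mat) tau i j :
  mmul d Q (mmul d (madd idm (mscal tau A)) X) i j
  = mmul d Q (mmul d idm X) i j + tau * mmul d Q (mmul d A X) i j.
Proof.
unfold mmul at 1 3 5; rewrite <- rsum_scal_l, <- rsum_plus.
apply rsum_ext; intros k _.
replace (mmul d (madd idm (mscal tau A)) X k j)
  with (mmul d idm X k j + tau * mmul d A X k j); [ring | ].
unfold mmul; rewrite <- rsum_scal_l, <- rsum_plus; apply rsum_ext; intros l _.
unfold madd, mscal; ring.
Qed.

Lemma shifted_product_bound d r eps tau beta AA C : (0 < d)%nat ->
  0 < r -> 0 < eps -> 0 < tau ->
  tau < 6 * eps / ((16 * INR d ^ 2 - 24 * INR d + 11) * r ^ 2) ->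
  eps < beta <= r -> 0 < C ->
  (forall A a, AA A -> is_eigenvalue d A a 0 -> - r <= a < - beta) ->
  (forall A, AA A -> only_real_eigenvalues d A) ->
  (forall l, schedule AA l -> entry_sum d (flow d l) <= C * exp (- beta * duration l)) ->
  exists q, 0 < q < 1 /\ forall l i j, (i < d)%nat -> (j < d)%nat ->
    (forall B, In B l -> shift_set tau AA B) -> Rabs (mprod d l i j) <= C * q ^ length l.
Proof.
intros Hd Hr Heps Htau Hlt Hb HC Hspec Hreal U.
destruct (euler_step_contraction r eps tau beta d Hr Heps Htau Hb Hd Hlt)
  as (q & Hq & Step).
exists q; split; auto; intros l i j Hi Hj Hl.
(* All schedules are treated at once: the hypothesis for sch followed by (t, A), over all t, is what
   bounds g on the half-line. *)
assert (key : forall sch, schedule AA sch ->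
  exp (beta * duration sch) * Rabs (mmul d (flow d sch) (mprod d l) i j)
    <= C * q ^ length l).
2:{ assert (K := key nil ltac:(intros p [])); simpl in K.
    rewrite Rmult_0_r, exp_0, Rmult_1_l, mmul_idm_l in K by auto; exact K. }
induction l as [ | B l IH]; intros sch Hsch.
- simpl; rewrite mmul_idm_r by auto; rewrite Rmult_1_r.
  apply Rle_trans with (exp (beta * duration sch) * (C * exp (- beta * duration sch))).
  + apply Rmult_le_compat_l; [left; apply exp_pos | ].
    apply Rle_trans with (2 := U sch Hsch); now apply entry_le_entry_sum.
  + right; replace (- beta * duration sch) with (- (beta * duration sch)) by ring.
    rewrite exp_Ropp; field; apply Rgt_not_eq, exp_pos.
- destruct (Hl B (or_introl eq_refl)) as (A & HA & ->).
  assert (IH' := IH (fun B' HB' => Hl B' (or_intror HB'))); clear IH.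
  set (X := mprod d l) in *.
  change (mprod d (madd idm (mscal tau A) :: l)) with (mmul d (madd idm (mscal tau A)) X).
  destruct (real_spectrum_annihilates d A (Hreal A HA)) as (s & Es & Hs & Ann).
  set (w := exp (beta * duration sch)).
  assert (Hw : 0 < w) by apply exp_pos.
  set (Q := flow d sch).
  set (g0 := fun t => exp (beta * t) * mmul d Q (mmul d (mexp d A t) X) i j).
  set (g := fun t => w * g0 t + 0 * 0).
  assert (Sg0 := mexp_entry_sol d A beta s Q X i j Ann); fold g0 in Sg0.
  set (hs := map (fun a => - (a + beta)) s) in *.
  assert (Sg : sol hs g).
  { apply (sol_lin hs w 0 g0 (fun _ => 0)); auto.
    clear; induction hs as [ | h hs IH]; [reflexivity | now apply sol_cons]. }
  assert (Hbound : forall t, 0 <= t -> Rabs (g t) <= C * q ^ length l).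
  { assert (E0 : forall t, Rabs (g t) = w * exp (beta * t) *
        Rabs (mmul d Q (mmul d (mexp d A t) X) i j)).
    { intro t; unfold g, g0; rewrite Rmult_0_l, Rplus_0_r, !Rabs_mult.
      rewrite (Rabs_pos_eq w), (Rabs_pos_eq (exp _)) by (left; auto; apply exp_pos).
      ring. }
    (* Segments have positive duration, so t = 0 uses the hypothesis for sch itself. *)
    intros t [Ht | <-]; rewrite E0.
    - assert (K := IH' (sch ++ (t, A) :: nil)
        ltac:(apply schedule_app; auto; apply schedule_cons; auto; intros p [])).
      rewrite duration_app in K; simpl duration in K.
      rewrite Rplus_0_r, Rmult_plus_distr_l, exp_plus in K.
      replace (mmul d Q (mmul d (mexp d A t) X) i j)
        with (mmul d (flow d (sch ++ (t, A) :: nil)) X i j); auto.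
      rewrite <- mmul_assoc; apply rsum_ext; intros k Hk; f_equal.
      rewrite flow_app by auto; apply rsum_ext; intros m Hm; f_equal.
      simpl; now apply mmul_idm_r.
    - rewrite mexp_0, Rmult_0_r, exp_0, Rmult_1_r, <- mmul_assoc.
      replace (mmul d (mmul d Q idm) X i j) with (mmul d Q X i j); [now apply IH' | ].
      apply rsum_ext; intros k Hk; now rewrite mmul_idm_r. }
  set (g' := fun t => w * (beta * exp (beta * t) * mmul d Q (mmul d (mexp d A t) X) i j
     + exp (beta * t) * mmul d Q (mmul d A (mmul d (mexp d A t) X)) i j)).
  assert (Dg : dv g g').
  { assert (Dm : dv (fun t => mmul d Q (mmul d (mexp d A t) X) i j)
      (fun t => mmul d Q (mmul d A (mmul d (mexp d A t) X)) i j)).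
    { apply (dv_rsum d (fun k t => Q i k * mmul d (mexp d A t) X k j)
        (fun k t => Q i k * mmul d A (mmul d (mexp d A t) X) k j)).
      intros k Hk; assert (D := dv_mexp_shift d A 0 X k j Hk).
      eapply dv_eq.
      - apply (dv_mult (fun _ => Q i k)); [apply dv_const | ].
        replace (fun t => mmul d (mexp d A t) X k j)
          with (fun t => mmul d (mexp d A (t - 0)) X k j); [exact D | ].
        extensionality t; now rewrite Rminus_0_r.
      - intro t; simpl; rewrite Rminus_0_r; ring. }
    unfold g, g0, g'; dv_auto. }
  assert (HK : 0 < C * q ^ length l) by (apply Rmult_lt_0_compat; auto; apply pow_lt; lra).
  assert (Fin := Step hs g g' (C * q ^ length l) ltac:(unfold hs; now rewrite length_map)
    ltac:(intros h Hh; apply in_map_iff in Hh; destruct Hh as (a & <- & Ha);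
          generalize (Hspec A a HA (Hs a Ha)); lra) Sg Dg HK Hbound).
  (* The weight contributes beta g 0 to g' 0, which the coefficient 1 - tau beta cancels. *)
  replace ((1 - tau * beta) * g 0 + tau * g' 0)
    with (w * mmul d Q (mmul d (madd idm (mscal tau A)) X) i j) in Fin.
  + rewrite Rabs_mult, (Rabs_pos_eq w) in Fin by lra.
    simpl length; simpl pow; lra.
  + rewrite mmul_madd_scal; unfold g, g', g0; rewrite mexp_0, Rmult_0_r, exp_0.
    replace (mmul d Q (mmul d A (mmul d idm X)) i j) with (mmul d Q (mmul d A X) i j);
      [ring | ].
    apply rsum_ext; intros k Hk; f_equal; apply rsum_ext; intros m Hm; f_equal.
    symmetry; now apply mmul_idm_l.
Qed.

(** Any rate p strictly between q and 1 absorbs the constant: K q^k < p^k for large k, where K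
    exceeds d^2 C. *)
Lemma jsr_lt_1 d M l C q : 0 < q < 1 -> 0 < C ->
  (forall s i j, (i < d)%nat -> (j < d)%nat -> (forall B, In B s -> M B) ->
    Rabs (mprod d s i j) <= C * q ^ length s) ->
  jsr_is d M l -> l < 1.
Proof.
intros Hq HC HB (u & Hu & Cu).
set (p := (1 + q) / 2).
assert (Hp : q < p < 1) by (unfold p; lra).
set (K := INR d * (INR d * C) + 1).
assert (HK : 0 < K).
{ unfold K; generalize (pos_INR d); intro; assert (0 <= INR d * C) by nra; nra. }
assert (Hqp : Rabs (q / p) < 1).
{ rewrite Rabs_pos_eq by (left; apply Rdiv_lt_0_compat; lra).
  apply (Rmult_lt_reg_r p); [lra | ].
  replace (q / p * p) with q by (field; lra); lra. }
destruct (pow_lt_1_zero (q / p) Hqp (/ K) ltac:(now apply Rinv_0_lt_compat)) as (N & HN).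
assert (Hle : forall k, (k >= N)%nat -> u k <= p).
{ intros k Hk; apply (proj2 (Hu k)); intros y (Hy & s & Ls & HM & Ey).
  apply Rnot_lt_le; intro L.
  assert (Bn : mnorm d (mprod d s) <= K * q ^ S k).
  { apply Rle_trans with (entry_sum d (mprod d s)).
    - unfold mnorm, entry_sum.
      apply Rle_trans with (vnorm d (fun i => rsum d (fun j => Rabs (mprod d s i j)))).
      + unfold vnorm; apply sqrt_le_1_alt, rsum_le; intros i Hi.
        assert (P0 := vnorm_le_rsum d (mprod d s i)).
        assert (P1 : 0 <= vnorm d (mprod d s i)) by apply sqrt_pos.
        assert (P2 : 0 <= rsum d (fun j => mprod d s i j ^ 2))
          by (apply rsum_nonneg; intros; apply pow2_ge_0).
        rewrite <- (pow2_sqrt _ P2).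
        apply pow_incr; split; auto.
      + apply Rle_trans with (1 := vnorm_le_rsum _ _); right; apply rsum_ext.
        intros i Hi; apply Rabs_pos_eq, rsum_nonneg; intros; apply Rabs_pos.
    - apply Rle_trans with (INR d * (INR d * (C * q ^ S k))).
      + unfold entry_sum; rewrite <- !rsum_const; apply rsum_le; intros i Hi.
        apply rsum_le; intros j Hj.
        rewrite <- Ls; now apply HB.
      + assert (0 < q ^ S k) by (apply pow_lt; lra).
        unfold K; lra. }
  rewrite <- Ey in Bn.
  assert (P1 : p ^ S k <= y ^ S k) by (apply pow_incr; lra).
  assert (Q := HN (S k) ltac:(lia)).
  assert (Pp : 0 < p ^ S k) by (apply pow_lt; lra).
  assert (E : (q / p) ^ S k * p ^ S k = q ^ S k).
  { rewrite <- Rpow_mult_distr; f_equal; field; lra. }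
  apply Rabs_def2 in Q; destruct Q as [Q _].
  apply (Rmult_lt_compat_r (p ^ S k)) in Q; auto; rewrite E in Q.
  apply (Rmult_lt_compat_l K) in Q; auto.
  replace (K * (/ K * p ^ S k)) with (p ^ S k) in Q by (field; lra).
  lra. }
apply Rle_lt_trans with p; [ | lra].
apply Rnot_lt_le; intro L.
destruct (Cu (l - p) ltac:(lra)) as (N' & HN').
specialize (HN' (max N N') ltac:(lia)); specialize (Hle (max N N') ltac:(lia)).
unfold Rdist in HN'; apply Rabs_def2 in HN'; lra.
Qed.

Theorem theorem4 (d : nat) (r eps : R) (Hr : 0 < r) (Heps : 0 < eps)
  (tau : R) (Htau0 : 0 < tau)
  (Htau : tau < 6 * eps / ((16 * INR d ^ 2 - 24 * INR d + 11) * r ^ 2))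
  (AA : Mat -> Prop) (Hcpt : compact_mset d AA)
  (Hreal : forall A, AA A -> only_real_eigenvalues d A)
  (Hrho : forall A rho, AA A -> spectral_radius_is d A rho -> rho <= r) :
  (exists l, jsr_is d (shift_set tau AA) l /\ 1 <= l) ->
  lyap_exp_ge d AA (- eps).
Proof.
intros (l & Hjsr & Hl) alpha HB; apply Rnot_lt_le; intro Hlt.
apply (Rle_not_lt _ _ Hl).
destruct (Nat.eq_0_gt_0_cases d) as [-> | Hd].
{ apply (jsr_lt_1 0 (shift_set tau AA) l 1 (1 / 2)); auto; try lra.
  intros s i j Hi; lia. }
(* For empty AA only the empty product exists, so the decay bound is trivial. *)
destruct (classic (exists A, AA A)) as [(A0 & HA0) | Hempty].
2:{ apply (jsr_lt_1 d (shift_set tau AA) l 1 (1 / 2)); auto; try lra.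
    intros [ | B s] i j Hi Hj HM.
    - simpl; unfold idm; destruct Nat.eqb; unfold Rabs; destruct Rcase_abs; lra.
    - destruct (HM B (or_introl eq_refl)) as (A & HA & _).
      elim Hempty; exists A; auto. }
assert (Hspec : forall A a, AA A -> is_eigenvalue d A a 0 -> - r <= a <= alpha).
{ intros A a HA Ha; split.
  - assert (B := real_eigenvalue_le_radius d A r a (Hreal A HA)
      (fun rho H => Hrho A rho HA H) Ha).
    apply Rabs_le_between in B; lra.
  - now apply (eigenvalue_le_exp_bound d AA alpha A). }
(* Needed for beta <= r. An eigenvalue exists because d > 0, and it lies between - r and alpha. *)
assert (Hra : - r <= alpha).
{ destruct (real_spectrum_annihilates d A0 (Hreal A0 HA0)) as (s & Es & Hs & _).
  destruct s as [ | a s]; [simpl in Es; lia | ].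
  generalize (Hspec A0 a HA0 (Hs a (or_introl eq_refl))); lra. }
destruct (exp_bound_uniform d AA alpha HB) as (C & HC & U).
(* [beta < - alpha] strictly, so that the exponents [a + beta] are negative. *)
set (beta := (eps - alpha) / 2).
destruct (shifted_product_bound d r eps tau beta AA C) as (q & Hq & HP); auto.
- unfold beta; lra.
- intros A a HA Ha; generalize (Hspec A a HA Ha); unfold beta; lra.
- intros s Hs; apply Rle_trans with (1 := U s Hs).
  apply Rmult_le_compat_l; [lra | ].
  assert (Hdur := duration_nonneg AA s Hs).
  destruct Hdur as [Hdur | <-]; [ | rewrite !Rmult_0_r; lra].
  left; apply exp_increasing, Rmult_lt_compat_r; auto; unfold beta; lra.
- now apply (jsr_lt_1 d (shift_set tau AA) l C q).
Qed.
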